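(* Let $0<r_1<r_2$, let $\Omega=\{r_1<r<r_2\}\subset\mathbb{R}^3$ be a spherical shell ($r$ the distance to the origin), let $g,q,b,z_d\in\mathbb{R}$, and for $\alpha>0$ let $u,p,u_\alpha,p_\alpha$ be the states and adjoint states defined in the context. Then $u_\alpha$ converges to $u$ and $p_\alpha$ converges to $p$ when $\alpha\to\infty$. In addition, there exists a positive constant $K_3=K_3(r_1,r_2,g,q)$ such that $$\|u_{\alpha}-u\|_{H^1(\Omega)}=\frac{K_3}{\alpha},\qquad\text{with } K_3=\left(\frac{4\pi( r_2^3-r_1^3 ) \left(3 q r_2^2 + g (r_1^3 - r_2^3)\right)^2}{27 r_1^4}\right)^{1/2}.$$ Analogously, a similar estimate holds for the adjoint states $p_\alpha$ and $p$: there exists a positive constant $L_3=L_3(r_1,r_2,g,q,b,z_d)$ such that $$\lim_{\alpha\to\infty} \alpha\, \|p_{\alpha}-p\|_{L^2(\Omega)} =L_3.$$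
   Context: $\Gamma_1=\{r=r_1\}$, $\Gamma_2=\{r=r_2\}$; $\partial/\partial n$ is the outward normal derivative. The following are the unique solutions of the respective mixed problems: $u$: $-\Delta u=g$ in $\Omega$, $u|_{\Gamma_1}=b$, $-\frac{\partial u}{\partial n}|_{\Gamma_2}=q$; $p$: $-\Delta p=u-z_d$ in $\Omega$, $p|_{\Gamma_1}=0$, $\frac{\partial p}{\partial n}|_{\Gamma_2}=0$; $u_\alpha$: $-\Delta u_\alpha=g$ in $\Omega$, $-\frac{\partial u_\alpha}{\partial n}|_{\Gamma_1}=\alpha(u_\alpha-b)$, $-\frac{\partial u_\alpha}{\partial n}|_{\Gamma_2}=q$; $p_\alpha$: $-\Delta p_\alpha=u_\alpha-z_d$ in $\Omega$, $-\frac{\partial p_\alpha}{\partial n}|_{\Gamma_1}=\alpha p_\alpha$, $\frac{\partial p_\alpha}{\partial n}|_{\Gamma_2}=0$. $\|v\|_{H^1(\Omega)}^2=\|v\|_{L^2(\Omega)}^2+\|\nabla v\|_{L^2(\Omega)}^2$.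
   Formalization: Positivity of K_3 (resp. L_3) is asserted only when u_α and u (resp. p_α and p) are not identical in Ω for all α>0; otherwise the constant is 0 (e.g. g=q=0, and b=z_d for L_3). The formula, equality and limits hold for all data. *)

(* Defs.v *)
From HB Require Import structures.
From mathcomp Require Import all_boot all_order all_algebra.
From mathcomp Require Import all_classical all_reals all_analysis.
Set Implicit Arguments.
Unset Strict Implicit.
Unset Printing Implicit Defensive.
Import Order.TTheory GRing.Theory Num.Theory.
Import numFieldNormedType.Exports.
Local Open Scope classical_set_scope.
Local Open Scope ring_scope.

Notation point3 R := (R * R * R)%type.

(* The library norm on a product is the sup norm (same topology), so the
   Euclidean norm is introduced separately. *)
Definition enorm (R : realType) (x : point3 R) : R :=
  Num.sqrt (x.1.1 ^+ 2 + x.1.2 ^+ 2 + x.2 ^+ 2).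

Definition shell (R : realType) (r1 r2 : R) : set (point3 R) :=
  [set x | r1 < enorm x < r2].

Definition closed_shell (R : realType) (r1 r2 : R) : set (point3 R) :=
  [set x | r1 <= enorm x <= r2].

Definition sphere (R : realType) (r : R) : set (point3 R) :=
  [set x | enorm x = r].

Definition basis_vec (R : realType) (i : 'I_3) : point3 R :=
  ((i == 0 :> nat)%:R, (i == 1 :> nat)%:R, (i == 2 :> nat)%:R).

Definition partial (R : realType) (i : 'I_3) (v : point3 R -> R) : point3 R -> R :=
  fun x => 'D_(basis_vec R i) v x.

Definition grad (R : realType) (v : point3 R -> R) (x : point3 R) : point3 R :=
  (partial (inord 0) v x, partial (inord 1) v x, partial (inord 2) v x).

Definition laplacian (R : realType) (v : point3 R -> R) (x : point3 R) : R :=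
  \sum_(i < 3) partial i (partial i v) x.

Definition is_C2 (R : realType) (A : set (point3 R)) (v : point3 R -> R) : Prop :=
  forall x, A x ->
    [/\ {for x, continuous v},
        forall i, derivable v x (basis_vec R i) /\
                  {for x, continuous (partial i v)} &
        forall i j, derivable (partial i v) x (basis_vec R j) /\
                    {for x, continuous (partial j (partial i v))}].

(* One-sided derivative of v in the direction n at a boundary point x, computed
   from the inside, n being the outward unit normal at x. *)
Definition has_normal_derivative (R : realType) (v : point3 R -> R)
    (x n : point3 R) (d : R) : Prop :=
  t^-1 * (v x - v (x - t *: n)) @[t --> 0^'+] --> d.

(* Outward unit normals of the shell on its inner and outer boundary spheres. *)
Definition inner_normal (R : realType) (x : point3 R) : point3 R :=
  - ((enorm x)^-1 *: x).

Definition outer_normal (R : realType) (x : point3 R) : point3 R :=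
  (enorm x)^-1 *: x.

(* - Laplacian v = f in the shell and - dv/dn = q on the outer sphere, for a
   classical v: twice continuously differentiable in the open shell and
   continuous up to the boundary. *)
Definition poisson_neumann (R : realType) (r1 r2 : R) (f : point3 R -> R) (q : R)
    (v : point3 R -> R) : Prop :=
  [/\ is_C2 (shell r1 r2) v,
      {within closed_shell r1 r2, continuous v},
      forall x, shell r1 r2 x -> - laplacian v x = f x &
      forall x, sphere r2 x ->
        exists2 d, has_normal_derivative v x (outer_normal x) d & - d = q].

Definition dirichlet_problem (R : realType) (r1 r2 : R) (f : point3 R -> R)
    (b q : R) (v : point3 R -> R) : Prop :=
  poisson_neumann r1 r2 f q v /\ (forall x, sphere r1 x -> v x = b).

Definition robin_problem (R : realType) (r1 r2 alpha : R) (f : point3 R -> R)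
    (b q : R) (v : point3 R -> R) : Prop :=
  poisson_neumann r1 r2 f q v /\
  (forall x, sphere r1 x ->
    exists2 d, has_normal_derivative v x (inner_normal x) d &
               - d = alpha * (v x - b)).

Definition L2norm (R : realType) (A : set (point3 R)) (v : point3 R -> R) : \bar R :=
  let lebesgue := @lebesgue_measure R in
  sqrte (\int[((lebesgue \x lebesgue) \x lebesgue)%E]_(x in A) (v x ^+ 2)%:E)%E.

(* Only meant for v differentiable in the open set A, where the weak and the
   pointwise gradients agree. *)
Definition H1norm (R : realType) (A : set (point3 R)) (v : point3 R -> R) : \bar R :=
  sqrte (L2norm A v ^+ 2 + L2norm A (fun x => enorm (grad v x)) ^+ 2)%E.

(* Main.v *)
Require Import Defs.
From HB Require Import structures.
From mathcomp Require Import all_boot all_order all_algebra.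
From mathcomp Require Import all_classical all_reals all_analysis.
From mathcomp Require Import measurable_realfun ring lra.
Set Implicit Arguments.
Unset Strict Implicit.
Unset Printing Implicit Defensive.
Import Order.TTheory GRing.Theory Num.Theory.
Import numFieldNormedType.Exports.
Local Open Scope classical_set_scope.
Local Open Scope ring_scope.

(** Every solution is an explicit radial function, and the theorem is read off
    the formulas.

    In the shell, [1], [1/r], [r^2], [r] and [r^4] have Laplacians [0], [0],
    [6], [2/r] and [20 r^2], so their combinations [rad a0 a1 a2 a3 a4] contain
    a solution of each of the four problems. The flux of the state through the
    inner sphere is fixed by [g] and [q]: it is the same for the Dirichlet and
    for the Robin condition. Hence [u_alpha - u] is the constant
    [u'(r1) / alpha] ([state_difference]), its gradient vanishes, and its
    [H^1] norm is [|u'(r1)| / alpha] times the square root of the volume of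
    the shell ([H1norm_state]).

    The difference [w] of the adjoint states satisfies
    [- Laplacian w = u'(r1) / alpha], has no flux through the outer sphere, and
    equals [p_alpha'(r1) / alpha] on the inner one. Hence
    [alpha w = H + c / alpha], where the profile [H] and the constant [c] do
    not depend on [alpha] ([adjoint_difference], [limit_profile]), and [L3] is
    the [L^2] norm of [H]. If [H] vanishes in the shell, then
    [u'(r1) = p'(r1) = 0] and [p_alpha = p] ([limit_profile_neq0]), which gives
    the positivity of [L3].

    Since the given functions are arbitrary classical solutions, they have to
    be identified with these formulas. Uniqueness ([dirichlet_unique],
    [robin_unique]) follows from a maximum principle: a strictly subharmonic
    function with negative normal derivative on the outer sphere attains its
    maximum over the closed shell on the inner sphere ([max_on_inner_sphere]).
    It applies to a difference of solutions after adding a small multiple of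
    [1/r + k r^2], whose Laplacian is positive and whose radial derivative at
    [r2] is negative; the inner boundary condition then bounds the maximum
    ([comparison]).

    The volume of the shell is computed from the product measure by slicing
    ([volume_ball]). *)

(** * Volume of a spherical shell *)

Section Volume.
Context {R : realType}.
Notation leb := (@lebesgue_measure R).

(** The boolean chooses between the open and the closed ball: the shell is an
    open ball minus a closed one. For negative [t] the set is empty and the
    square root is zero, so that no case distinction is left to the callers. *)
Lemma length_sqr_lt (b : bool) (t : R) :
  leb [set x | x ^+ 2 < t ?<= if b] = (2 * Num.sqrt t)%:E.
Proof.
have [t0|t0] := ltrP t 0.
  rewrite ltr0_sqrtr// mulr0 (_ : [set x | _] = set0) ?measure0//.
  apply/seteqP; split => // x /= /lteifW xt.
  by have := sqr_ge0 x; rewrite leNgt (le_lt_trans xt).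
have [->|tn0] := eqVneq t 0.
  rewrite sqrtr0 mulr0; case: b => /=.
    rewrite (_ : [set x | _] = [set 0]) ?lebesgue_measure_set1//.
    apply/seteqP; split => x /=; last by move=> ->; rewrite expr0n.
    by move=> x0; apply/eqP; rewrite -sqrf_eq0 eq_le x0 sqr_ge0.
  rewrite (_ : [set x | _] = set0) ?measure0//.
  by apply/seteqP; split => // x /=; rewrite ltNge sqr_ge0.
have s0 : 0 < Num.sqrt t by rewrite sqrtr_gt0 lt_neqAle eq_sym tn0.
have -> : [set x | x ^+ 2 < t ?<= if b] =
    [set` Interval (BSide b (- Num.sqrt t)) (BSide (~~ b) (Num.sqrt t))].
  apply/seteqP; split => x /=; rewrite in_itv/= negbK.
    rewrite -lteif_norml -sqrtr_sqr; case: b => /=.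
      by move=> xt; rewrite ler_wsqrtr.
    by move=> xt; rewrite ltr_sqrt// lt_neqAle eq_sym tn0.
  rewrite -lteif_norml -sqrtr_sqr; case: b => /=.
    by rewrite ler_sqrt.
  by rewrite ltr_sqrt// lt_neqAle eq_sym tn0.
rewrite lebesgue_measure_itv/= lte_fin gtrN// -EFinB; congr EFin; ring.
Qed.

Lemma is_derive_continuous (f : R -> R) (x df : R) :
  is_derive x 1 f df -> {for x, continuous f}.
Proof. by move=> [dfx _]; exact/differentiable_continuous/derivable1_diffP. Qed.

Lemma FTC2_is_derive (f F : R -> R) (a b : R) : a < b -> continuous f ->
  (forall x : R, is_derive x 1 F (f x)) ->
  (\int[leb]_(x in `[a, b]) (f x)%:E = (F b - F a)%:E)%E.
Proof.
move=> ab cf dF; rewrite (@continuous_FTC2 _ _ F)//.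
- exact: continuous_subspaceT.
- split; first by move=> x _; exact: ex_derive.
  + exact/cvg_at_right_filter/(is_derive_continuous (dF a)).
  + exact/cvg_at_left_filter/(is_derive_continuous (dF b)).
- by move=> x _; rewrite derive1E; exact: derive_val.
Qed.

(** The chords of a disc of radius [sqrt t] integrate to its area. Substitute
    [x = sqrt t * sin theta]. *)
Lemma integral_chord (t : R) : 0 <= t ->
  (\int[leb]_x (2 * Num.sqrt (t - x ^+ 2))%:E = (pi * t)%:E)%E.
Proof.
rewrite le_eqVlt => /predU1P[<-|t0].
  rewrite mulr0; apply: integral0_eq => x _.
  by rewrite ler0_sqrtr ?mulr0// sub0r oppr_le0 sqr_ge0.
pose s := Num.sqrt t.
have s0 : 0 < s by rewrite sqrtr_gt0.
have ts : t = s ^+ 2 by rewrite sqr_sqrtr// ltW.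
pose F (x : R) : R := s * sin x.
have pi2 : - (pi / 2) < pi / 2 :> R by rewrite gtrN// divr_gt0// pi_gt0.
have F1 : F (- (pi / 2)) = - s by rewrite /F sinN sin_pihalf mulrN1.
have F2 : F (pi / 2) = s by rewrite /F sin_pihalf mulr1.
have dF (x : R) : is_derive (x : R) (1 : R) F (s * cos x).
  by apply: is_derive_eq; rewrite /GRing.scale/=; ring.
have dFE : derive1 F = fun x => s * cos x.
  by apply/funext => x; rewrite derive1E; exact: derive_val.
have cdF : continuous (derive1 F).
  by rewrite dFE => x; apply: cvgM; [exact: cvg_cst|exact: continuous_cos].
have cF : continuous F.
  by move=> x; apply: cvgM; [exact: cvg_cst|exact: continuous_sin].
transitivity (\int[leb]_(x in `[F (- (pi / 2))%R, F (pi / 2)%R])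
    (2 * Num.sqrt (t - x ^+ 2))%:E)%E.
  rewrite F1 F2 [RHS]integral_mkcond; apply: eq_integral => x _.
  rewrite patchE; case: ifPn => // /negP; rewrite inE/= in_itv/= => xs.
  rewrite ler0_sqrtr ?mulr0// subr_le0 ts leNgt; apply/negP => xs'; apply: xs.
  by rewrite -ler_norml -ler_sqr ?nnegrE ?(ltW s0)// real_normK ?num_real// ltW.
rewrite integration_by_substitution_increasing; first last.
- apply: continuous_subspaceT => x; apply: cvgM; first exact: cvg_cst.
  apply: (@cvg_comp _ _ _ (fun x : R => t - x ^+ 2) Num.sqrt _
    (nbhs (t - x ^+ 2))); last exact: sqrt_continuous.
  by apply: cvgB; [exact: cvg_cst|exact: exprn_continuous].
- split; first by move=> x _; exact: ex_derive.
  + exact/cvg_at_right_filter/cF.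
  + exact/cvg_at_left_filter/cF.
- by apply/cvg_ex; eexists; exact/cvg_at_left_filter/cdF.
- by apply/cvg_ex; eexists; exact/cvg_at_right_filter/cdF.
- by move=> x _; exact: cdF.
- by move=> x y xI yI xy; rewrite /F ltr_pM2l// ltr_sin.
- exact: ltW.
(* on the interval of integration cos is nonnegative, so the square root
   disappears *)
transitivity (\int[leb]_(x in `[(- (pi / 2))%R, (pi / 2)%R])
    (s ^+ 2 * (1 + cos x ^+ 2 - sin x ^+ 2))%:E)%E.
  apply: eq_integral => x; rewrite inE/= in_itv/= => xI; congr EFin.
  rewrite dFE.
  change (2 * Num.sqrt (t - (s * sin x) ^+ 2) * (s * cos x) =
    s ^+ 2 * (1 + cos x ^+ 2 - sin x ^+ 2)).
  rewrite (_ : t - _ = (s * cos x) ^+ 2); last first.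
    by rewrite ts !exprMn cos2sin2; ring.
  rewrite sqrtr_sqr ger0_norm ?mulr_ge0 ?(ltW s0) ?cos_ge0_pihalf//.
  by rewrite sin2cos2; ring.
pose G (z : R) := s ^+ 2 * (z + sin z * cos z).
have dG (x : R) : is_derive x 1 G (s ^+ 2 * (1 + cos x ^+ 2 - sin x ^+ 2)).
  by apply: is_derive_eq; rewrite /GRing.scale/=; ring.
rewrite (FTC2_is_derive pi2 _ dG) /G.
  rewrite sinN cosN sin_pihalf cos_pihalf; congr EFin.
  by rewrite ts; field.
move=> x; apply: cvgM; first exact: cvg_cst.
apply: cvgB; first apply: cvgD; first exact: cvg_cst.
  exact: (continuous_comp (@continuous_cos R x) (@exprn_continuous R 2 _)).
exact: (continuous_comp (@continuous_sin R x) (@exprn_continuous R 2 _)).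
Qed.

Lemma integral_chord_max (t : R) :
  (\int[leb]_x (2 * Num.sqrt (t - x ^+ 2))%:E = (pi * Num.max t 0)%:E)%E.
Proof.
have [t0|t0] := lerP 0 t; first by rewrite integral_chord.
rewrite mulr0 integral0_eq// => x _.
by rewrite ltr0_sqrtr ?mulr0// subr_lt0 (lt_le_trans t0)// sqr_ge0.
Qed.

(** The discs cut out of a ball of radius [sqrt t] integrate to its volume. *)
Lemma integral_disc (t : R) : 0 <= t ->
  (\int[leb]_x (pi * Num.max (t - x ^+ 2) 0)%:E =
    (4 / 3 * pi * Num.sqrt t ^+ 3)%:E)%E.
Proof.
rewrite le_eqVlt => /predU1P[<-|t0].
  rewrite sqrtr0 expr0n mulr0; apply: integral0_eq => x _.
  by rewrite max_r ?mulr0// sub0r oppr_le0 sqr_ge0.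
pose s := Num.sqrt t.
have s0 : 0 < s by rewrite sqrtr_gt0.
have ts : t = s ^+ 2 by rewrite sqr_sqrtr// ltW.
transitivity (\int[leb]_(x in `[(- s)%R, s]) (pi * (t - x ^+ 2))%:E)%E.
  rewrite [RHS]integral_mkcond; apply: eq_integral => x _.
  rewrite patchE; case: ifPn => [|/negP]; rewrite inE/= in_itv/= => xs.
    rewrite max_l// subr_ge0 ts -[x ^+ 2]real_normK ?num_real//.
    by rewrite ler_sqr ?nnegrE ?(ltW s0)// ler_norml.
  rewrite max_r ?mulr0// subr_le0 ts leNgt; apply/negP => xs'; apply: xs.
  by rewrite -ler_norml -ler_sqr ?nnegrE ?(ltW s0)// real_normK ?num_real// ltW.
have dF (x : R) :
    is_derive x 1 (fun z => pi * (t * z - z ^+ 3 / 3)) (pi * (t - x ^+ 2)).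
  by apply: is_derive_eq; rewrite /GRing.scale/=; field.
rewrite (FTC2_is_derive _ _ dF).
- by congr EFin; rewrite -/s ts; field.
- by rewrite gtrN.
- move=> x; apply: cvgM; first exact: cvg_cst.
  by apply: cvgB; [exact: cvg_cst|exact: exprn_continuous].
Qed.

Lemma measurable_lteif d (T : measurableType d) (f : T -> R) (b : bool)
    (t : R) :
  measurable_fun setT f -> measurable [set x | f x < t ?<= if b].
Proof.
move=> mf; have -> : [set x | f x < t ?<= if b] =
    setT `&` f @^-1` [set` Interval -oo%O (BSide (~~ b) t)].
  rewrite setTI; apply/seteqP; split => x /=; rewrite in_itv/= negbK//.
exact: mf.
Qed.

(** Slicing twice: first along the third axis, which leaves chords over a disc,
    then, by Tonelli, along the second one, which leaves discs. *)
Lemma volume_ball (b : bool) (t : R) : 0 <= t ->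
  ((leb \x leb) \x leb)%E
    [set x : R * R * R | x.1.1 ^+ 2 + x.1.2 ^+ 2 + x.2 ^+ 2 < t ?<= if b] =
  (4 / 3 * pi * Num.sqrt t ^+ 3)%:E.
Proof.
move=> t0.
transitivity (\int[(leb \x leb)%E]_x
    (2 * Num.sqrt (t - (x.1 ^+ 2 + x.2 ^+ 2)))%:E)%E.
  rewrite -[LHS]/(\int[(leb \x leb)%E]_x leb (xsection _ x))%E.
  apply: eq_integral => x _ /=; rewrite -(length_sqr_lt b); congr (leb _).
  by apply/seteqP; split => y; rewrite /xsection/= inE/=;
    case: b => /=; rewrite (lerBrDl, ltrBrDl).
rewrite fubini_tonelli1/=; first last.
- by move=> x; rewrite lee_fin mulr_ge0// sqrtr_ge0.
- apply/measurable_EFinP/measurable_funM => //.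
  apply: measurableT_comp.
    by apply: continuous_measurable_fun; exact: sqrt_continuous.
  apply: measurable_funB => //; apply: measurable_funD.
    by apply: measurable_funX; exact: measurable_fst.
  by apply: measurable_funX; exact: measurable_snd.
rewrite -integral_disc//; apply: eq_integral => x _.
rewrite -integral_chord_max /fubini_F; apply: eq_integral => y _ /=.
by rewrite opprD addrA.
Qed.
End Volume.

(** * Calculus of radial functions *)

Section Radial.
Context {R : realType}.
Implicit Types (x y v w : point3 R) (f g h : R -> R).

Definition dot x y : R := x.1.1 * y.1.1 + x.1.2 * y.1.2 + x.2 * y.2.

Lemma dotxx x : dot x x = enorm x ^+ 2.
Proof.
by rewrite /dot -!expr2 /enorm sqr_sqrtr// !addr_ge0// sqr_ge0.
Qed.

Lemma enormE x : enorm x = Num.sqrt (dot x x).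
Proof. by rewrite /enorm /dot -!expr2. Qed.

Lemma enorm_ge0 x : 0 <= enorm x.
Proof. exact: sqrtr_ge0. Qed.

Lemma enormZ (a : R) x : enorm (a *: x) = `|a| * enorm x.
Proof.
rewrite -sqrtr_sqr enormE [enorm x]enormE -sqrtrM ?sqr_ge0//.
by congr Num.sqrt; rewrite /dot /= /GRing.scale/=; ring.
Qed.

Lemma coord_continuous :
  [/\ continuous (fun x : point3 R => x.1.1),
      continuous (fun x : point3 R => x.1.2)
    & continuous (fun x : point3 R => x.2)].
Proof.
split=> -[[a b] c].
- apply: (@cvg_comp _ _ _ fst fst _ (nbhs (a, b))); first exact: cvg_fst.
  exact: (@cvg_fst _ _ (nbhs a) (nbhs b)).
- apply: (@cvg_comp _ _ _ fst snd _ (nbhs (a, b))); first exact: cvg_fst.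
  exact: (@cvg_snd _ _ (nbhs a) (nbhs b)).
- exact: (@cvg_snd _ _ (nbhs (a, b)) (nbhs c)).
Qed.

Lemma dot_continuous y : continuous (dot ^~ y).
Proof.
have [c1 c2 c3] := coord_continuous.
move=> x; apply: cvgD; first apply: cvgD.
- by apply: cvgM; [exact: c1|exact: cvg_cst].
- by apply: cvgM; [exact: c2|exact: cvg_cst].
- by apply: cvgM; [exact: c3|exact: cvg_cst].
Qed.

Lemma enorm_continuous : continuous (@enorm R).
Proof.
have [c1 c2 c3] := coord_continuous.
move=> x; apply: (@cvg_comp _ _ _ _ Num.sqrt _
  (nbhs (x.1.1 ^+ 2 + x.1.2 ^+ 2 + x.2 ^+ 2))); last exact: sqrt_continuous.
apply: cvgD; first apply: cvgD.
- exact: (continuous_comp (c1 x) (@exprn_continuous R 2 _)).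
- exact: (continuous_comp (c2 x) (@exprn_continuous R 2 _)).
- exact: (continuous_comp (c3 x) (@exprn_continuous R 2 _)).
Qed.

Lemma near_enorm_gt x (a : R) : a < enorm x -> \forall y \near x, a < enorm y.
Proof. by move=> ax; apply: (cvgr_gt _ (@enorm_continuous x)). Qed.

Lemma near_enorm_lt x (a : R) : enorm x < a -> \forall y \near x, enorm y < a.
Proof. by move=> ax; apply: (cvgr_lt _ (@enorm_continuous x)). Qed.

Lemma near_shell (r1 r2 : R) x :
  shell r1 r2 x -> \forall y \near x, shell r1 r2 y.
Proof.
move=> /andP[/near_enorm_gt r1x /near_enorm_lt xr2].
by near=> y; apply/andP; split; near: y.
Unshelve. all: by end_near. Qed.

Lemma near_eq_continuous (F G : point3 R -> R) x : (\near x, F x = G x) ->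
  {for x, continuous F} -> {for x, continuous G}.
Proof.
move=> FG cF; rewrite /prop_for /continuous_at -(nbhs_singleton FG).
by apply: cvg_trans cF; exact: near_eq_cvg.
Qed.

(** Directional derivatives are derivatives along a line, so that the chain rule
    of one real variable applies to them. *)
Lemma derive_line (F : point3 R -> R) x v :
  'D_v F x = 'D_1 (fun t : R => F (t *: v + x)) 0.
Proof.
rewrite /derive (_ : (fun t => t^-1 *: ((F \o shift x) (t *: v) - F x)) =
  (fun t => t^-1 *: (((fun s => F (s *: v + x)) \o shift 0) (t *: 1) -
    F (0 *: v + x))))//.
by apply/funext => t /=; rewrite addr0 scale0r add0r [_%:A]mulr1.
Qed.

Lemma is_derive_line (F : point3 R -> R) x v (d : R) :
  is_derive x v F d <-> is_derive (0 : R) 1 (fun t : R => F (t *: v + x)) d.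
Proof.
split=> -[dF <-].
  by rewrite derive_line; apply: DeriveDef => //; exact: (derivable1P _ _ _).1.
by rewrite -derive_line; apply: DeriveDef => //; exact: (derivable1P _ _ _).2.
Qed.

Lemma is_derive_scalar_comp f (F : point3 R -> R) x v (c d : R) :
  is_derive (F x) 1 f c -> is_derive x v F d ->
  is_derive x v (fun y => f (F y)) (c * d).
Proof.
move=> df /is_derive_line dF; apply/is_derive_line.
have := @is_derive1_comp _ f (fun t : R => F (t *: v + x)) 0 c d.
by apply => //; rewrite scale0r add0r.
Qed.

Lemma is_derive_dot x v y : is_derive x v (dot ^~ y) (dot v y).
Proof.
apply/is_derive_line; rewrite /dot /=.
by apply: is_derive_eq; rewrite /GRing.scale/=; ring.
Qed.

Lemma is_derive_enorm x v : 0 < enorm x ->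
  is_derive x v (@enorm R) (dot x v / enorm x).
Proof.
move=> x0.
have dp : is_derive x v (fun y => dot y y) (2 * dot x v).
  apply/is_derive_line; rewrite /dot/=.
  by apply: is_derive_eq; rewrite /GRing.scale/=; ring.
have ds : is_derive (dot x x) 1 Num.sqrt (2 * Num.sqrt (dot x x))^-1.
  by apply: is_derive1_sqrt; rewrite dotxx exprn_gt0.
have := is_derive_scalar_comp (F := fun y => dot y y) ds dp.
rewrite -enormE (_ : (fun y => Num.sqrt (dot y y)) = @enorm R); last first.
  by apply/funext => y; rewrite enormE.
by move=> dn; apply: is_derive_eq; field; rewrite gt_eqF.
Qed.

(** The derivative of the profile [f] is written [t * g t] rather than named by
    itself: the gradient of [f(r)] is then [g(r) x], without quotients by [r],
    and [g(r)] is again a radial function to which the same rule applies. *)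
Lemma is_derive_radial f g x v :
  (forall t : R, 0 < t -> is_derive t 1 f (t * g t)) -> 0 < enorm x ->
  is_derive x v (fun y => f (enorm y)) (g (enorm x) * dot x v).
Proof.
move=> df x0; have dn := is_derive_enorm v x0.
have dfn := is_derive_scalar_comp (df _ x0) dn.
by apply: is_derive_eq; field; rewrite gt_eqF.
Qed.

Lemma is_derive2_radial g h x v w :
  (forall t : R, 0 < t -> is_derive t 1 g (t * h t)) -> 0 < enorm x ->
  is_derive x w (fun y => g (enorm y) * dot y v)
    (h (enorm x) * dot x w * dot x v + g (enorm x) * dot w v).
Proof.
move=> dg x0; have dn := is_derive_radial w dg x0.
have dd := is_derive_dot x w v.
by apply: is_derive_eq; rewrite /GRing.scale/=; ring.
Qed.

Lemma radial_continuous f x : {for enorm x, continuous f} ->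
  {for x, continuous (fun y => f (enorm y))}.
Proof. by move=> cf; apply: continuous_comp => //; exact: enorm_continuous. Qed.

Lemma partial_radial f g x i :
  (forall t : R, 0 < t -> is_derive t 1 f (t * g t)) -> 0 < enorm x ->
  partial i (fun y => f (enorm y)) x = g (enorm x) * dot x (basis_vec R i).
Proof.
move=> df x0; have dfx := is_derive_radial (basis_vec R i) df x0.
exact: derive_val.
Qed.

(** The formula holds on a neighbourhood, hence it can be differentiated. *)
Lemma near_partial_radial f g x i :
  (forall t : R, 0 < t -> is_derive t 1 f (t * g t)) -> 0 < enorm x ->
  \forall y \near x, g (enorm y) * dot y (basis_vec R i) =
    partial i (fun z => f (enorm z)) y.
Proof.
move=> df x0; near=> y; rewrite (partial_radial i df)//.
by near: y; exact: near_enorm_gt.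
Unshelve. all: by end_near. Qed.

Lemma is_derive_partial_radial f g h x i w :
  (forall t : R, 0 < t -> is_derive t 1 f (t * g t)) ->
  (forall t : R, 0 < t -> is_derive t 1 g (t * h t)) -> 0 < enorm x ->
  is_derive x w (partial i (fun y => f (enorm y)))
    (h (enorm x) * dot x w * dot x (basis_vec R i) +
     g (enorm x) * dot w (basis_vec R i)).
Proof.
move=> df dg x0; apply: near_eq_is_derive (is_derive2_radial _ _ dg x0).
exact: near_partial_radial.
Qed.

Lemma near_partial2_radial f g h x i j :
  (forall t : R, 0 < t -> is_derive t 1 f (t * g t)) ->
  (forall t : R, 0 < t -> is_derive t 1 g (t * h t)) -> 0 < enorm x ->
  \forall y \near x,
    h (enorm y) * dot y (basis_vec R j) * dot y (basis_vec R i) +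
     g (enorm y) * dot (basis_vec R j) (basis_vec R i) =
    partial j (partial i (fun z => f (enorm z))) y.
Proof.
move=> df dg x0; near=> y.
have y0 : 0 < enorm y by near: y; exact: near_enorm_gt.
have dfy := is_derive_partial_radial i (basis_vec R j) df dg y0.
by rewrite -[RHS]/('D_(basis_vec R j) _ y) derive_val.
Unshelve. all: by end_near. Qed.

Lemma is_C2_radial f g h (A : set (point3 R)) :
  (forall t : R, 0 < t -> is_derive t 1 f (t * g t)) ->
  (forall t : R, 0 < t -> is_derive t 1 g (t * h t)) ->
  (forall t : R, 0 < t -> {for t, continuous h}) ->
  (forall x, A x -> 0 < enorm x) ->
  is_C2 A (fun x => f (enorm x)).
Proof.
move=> df dg ch A0 x /A0 x0; split.
- by apply: radial_continuous; exact: is_derive_continuous (df _ x0).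
- move=> i; have dfx := is_derive_radial (basis_vec R i) df x0; split => //.
  apply: (near_eq_continuous (near_partial_radial i df x0)).
  apply: cvgM; last exact: dot_continuous.
  by apply: radial_continuous; exact: is_derive_continuous (dg _ x0).
- move=> i j; have dfx := is_derive_partial_radial i (basis_vec R j) df dg x0.
  split => //.
  apply: (near_eq_continuous (near_partial2_radial i j df dg x0)).
  apply: cvgD; last first.
    apply: cvgM; last exact: cvg_cst.
    by apply: radial_continuous; exact: is_derive_continuous (dg _ x0).
  apply: cvgM; last exact: dot_continuous.
  apply: cvgM; last exact: dot_continuous.
  by apply: radial_continuous; exact: ch.
Qed.

(** The sum over the basis vectors [e] of [h (x.e)^2 + g (e.e)]. *)
Lemma laplacian_radial f g h x :
  (forall t : R, 0 < t -> is_derive t 1 f (t * g t)) ->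
  (forall t : R, 0 < t -> is_derive t 1 g (t * h t)) -> 0 < enorm x ->
  laplacian (fun y => f (enorm y)) x =
    h (enorm x) * enorm x ^+ 2 + 3 * g (enorm x).
Proof.
move=> df dg x0; rewrite /laplacian -dotxx.
under eq_bigr => i _ do
  rewrite -(nbhs_singleton (near_partial2_radial i i df dg x0)).
by rewrite !big_ord_recl big_ord0 /dot/=; ring.
Qed.

Lemma enorm_grad_radial f g x :
  (forall t : R, 0 < t -> is_derive t 1 f (t * g t)) -> 0 < enorm x ->
  enorm (grad (fun y => f (enorm y)) x) = enorm x * `|g (enorm x)|.
Proof.
move=> df x0; rewrite /grad !(partial_radial _ df x0).
rewrite [enorm x * _]mulrC -enormZ; congr enorm.
rewrite /dot /basis_vec !inordK//=.
by case: x {x0} => -[a b] c /=; congr (_, _, _); rewrite /GRing.scale/=; ring.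
Qed.

(** [s = 1] is the outer unit normal and [s = -1] the inner one. *)
Lemma enorm_shift_normal (s t : R) x : 0 < enorm x -> s * t < enorm x ->
  enorm (x - t *: (s *: ((enorm x)^-1 *: x))) = enorm x - s * t.
Proof.
move=> x0 st.
have -> : x - t *: (s *: ((enorm x)^-1 *: x)) = (1 - s * t / enorm x) *: x.
  by rewrite scalerBl scale1r !scalerA; congr (_ - _ *: _); ring.
rewrite enormZ ger0_norm; first by field; rewrite gt_eqF.
by rewrite subr_ge0 ler_pdivrMr// mul1r ltW.
Qed.

Lemma normal_derivative_radial (s d : R) f x : 0 < enorm x ->
  is_derive (enorm x) 1 f d ->
  has_normal_derivative (fun y => f (enorm y)) x (s *: ((enorm x)^-1 *: x))
    (s * d).
Proof.
move=> x0 df.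
have dl : is_derive (0 : R) 1 (fun t => f (enorm x - s * t)) (- (s * d)).
  have := @is_derive1_comp _ f (fun t => enorm x - s * t) 0 d (- s).
  rewrite mulrN [d * s]mulrC; apply.
    by rewrite mulr0 subr0.
  by apply: is_derive_eq; rewrite /GRing.scale/=; ring.
have [ddl lE] := dl; rewrite /has_normal_derivative -[s * d]opprK -lE.
apply: (@cvg_trans _ ((fun t : R =>
    - (t^-1 *: (f (enorm x - s * t) - f (enorm x)))) @ 0^'+)).
  apply: near_eq_cvg; near=> t.
  rewrite enorm_shift_normal//; first by rewrite -mulrN opprB.
  rewrite (le_lt_trans (ler_norm _))// normrM.
  have t0 : 0 < t by near: t; exact: nbhs_right_gt.
  rewrite (gtr0_norm t0).
  have t1 : t < enorm x / (`|s| + 1).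
    by near: t; apply: nbhs_right_lt; rewrite divr_gt0// ltr_wpDl.
  move: t1; rewrite ltr_pdivlMr ?ltr_wpDl// => t1.
  by rewrite (le_lt_trans _ t1)// mulrC ler_pM2l// lerDl.
apply: cvgN; apply: (@cvg_trans _ ((fun t : R =>
    t^-1 *: (f (enorm x - s * (t *: 1 + 0)) - f (enorm x - s * 0))) @ 0^'+)).
  by apply: near_eq_cvg; near=> t; rewrite addr0 [_%:A]mulr1 mulr0 subr0.
apply: cvg_trans ddl => A /= [e egt0 Ae]; exists e => // y xe ygt0.
by apply: Ae => //; exact/lt0r_neq0.
Unshelve. all: by end_near. Qed.

Lemma poisson_neumann_radial f g h (r1 r2 : R) : 0 < r1 -> r1 < r2 ->
  (forall t : R, 0 < t -> is_derive t 1 f (t * g t)) ->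
  (forall t : R, 0 < t -> is_derive t 1 g (t * h t)) ->
  (forall t : R, 0 < t -> {for t, continuous h}) ->
  poisson_neumann r1 r2
    (fun x => - (h (enorm x) * enorm x ^+ 2 + 3 * g (enorm x))) (- (r2 * g r2))
    (fun x => f (enorm x)).
Proof.
move=> r10 r12 df dg ch; split.
- by apply: is_C2_radial df dg ch _ => x /andP[r1x _]; exact: lt_trans r1x.
- apply: continuous_in_subspaceT => x; rewrite inE => /andP[r1x _].
  have x0 := lt_le_trans r10 r1x.
  by apply: radial_continuous; exact: is_derive_continuous (df _ x0).
- move=> x /andP[r1x _]; have x0 := lt_trans r10 r1x.
  by rewrite (laplacian_radial df dg x0).
- move=> x xr2; exists (r2 * g r2) => //.
  have x0 : 0 < enorm x by rewrite xr2 (lt_trans r10).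
  rewrite /outer_normal -[_ *: x]scale1r -[_ * _]mul1r.
  apply: normal_derivative_radial => //; rewrite xr2.
  exact/df/(lt_trans r10).
Qed.

Lemma inner_normal_derivative_radial f (d : R) x : 0 < enorm x ->
  is_derive (enorm x) 1 f d ->
  has_normal_derivative (fun y => f (enorm y)) x (inner_normal x) (- d).
Proof.
move=> x0 df; have := normal_derivative_radial (s := -1) x0 df.
by rewrite scaleN1r mulN1r.
Qed.

End Radial.

(** * Second-derivative test and linearity of the boundary value problem *)

Section MaximumPrinciple.
Context {R : realType}.
Implicit Types (x y n : point3 R) (v w : point3 R -> R).

(** The first derivative vanishes at the maximum. If the second one were
    positive, the first one would be positive just to the right of it, and the
    mean value theorem would give a larger value there. *)
Lemma second_derive_le0 (phi : R -> R) :
  (\forall t \near (0 : R), derivable phi t 1) ->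
  derivable (fun t => 'D_1 phi t) 0 1 ->
  (\forall t \near (0 : R), phi t <= phi 0) ->
  'D_1 (fun t => 'D_1 phi t) 0 <= 0.
Proof.
move=> dphi ddphi mphi; rewrite leNgt; apply/negP => D0.
have [e /= e0 He] : exists2 e : R, 0 < e &
    forall t, `|t| < e -> derivable phi t 1 /\ phi t <= phi 0.
  have /nbhs_ballP[e /= e0 He] : \forall t \near (0 : R),
      derivable phi t 1 /\ phi t <= phi 0 by near=> t; split; near: t.
  exists e; [exact: e0|move=> t te; apply: He].
  by rewrite -ball_normE /= sub0r normrN.
have phi'0 : 'D_1 phi 0 = 0.
  have e0' : 0 \in `](- e), e[ by rewrite in_itv/= oppr_lt0 e0.
  have := @derive1_at_max _ phi (- e) e 0 _ _ e0' _.
  move=> H; apply: derive_val; apply: H.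
  - by rewrite ge0_cp// ltW.
  - by move=> t; rewrite in_itv/= -ltr_norml => /He[].
  - by move=> t; rewrite in_itv/= -ltr_norml => /He[].
have [d /= d0 Hd] : exists2 d : R, 0 < d &
    forall t, 0 < t -> t < d -> 0 < 'D_1 phi t.
  have : \forall t \near 0^', 0 < t^-1 *: ('D_1 phi (t *: 1 + 0) - 'D_1 phi 0).
    exact: (cvgr_gt _ ddphi).
  move=> [d /= d0 Hd].
  exists d => // t t0 td; have := Hd t.
  rewrite /= sub0r normrN gtr0_norm// => /(_ td); rewrite gt_eqF// => /(_ isT).
  by rewrite addr0 [_%:A]mulr1 phi'0 subr0 /GRing.scale/= pmulr_rgt0// invr_gt0.
pose t := Num.min e d / 2.
have m0 : 0 < Num.min e d by rewrite lt_min e0.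
have t0 : 0 < t by rewrite divr_gt0.
have tm : t < Num.min e d by rewrite ltr_pdivrMr// ltr_pMr// ltr1n.
have [te td] : t < e /\ t < d by apply/andP; rewrite -lt_min.
have dphi' s : s \in `[0, t] -> derivable phi s 1.
  rewrite in_itv/= => /andP[s0 st]; apply: (He _ _).1.
  by rewrite ger0_norm// (le_lt_trans st).
have [c c0t] : exists2 c, c \in `]0, t[ & phi t - phi 0 = 'D_1 phi c * (t - 0).
  apply: MVT; first exact: t0.
    by move=> s s0t; apply/derivableP/dphi'; apply: subset_itv_oo_cc.
  exact: derivable_within_continuous.
rewrite subr0 => phiE.
have : 0 < phi t - phi 0.
  move: c0t; rewrite phiE in_itv/= => /andP[c0 ct].
  by rewrite mulr_gt0// Hd// (lt_trans ct).
by rewrite subr_gt0 ltNge (He _ _).2// gtr0_norm.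
Unshelve. all: by end_near. Qed.

Lemma line_growth_rate v x e (t : R) :
  (fun h : R => h^-1 *: (((fun s : R => v (s *: e + x)) \o shift t) (h *: 1) -
    v (t *: e + x))) =
  (fun h : R => h^-1 *: ((v \o shift (t *: e + x)) (h *: e) - v (t *: e + x))).
Proof.
by apply/funext => h /=; rewrite scalerDl addrA [_%:A]mulr1.
Qed.

Lemma derivable_along_line v x e (t : R) : derivable v (t *: e + x) e ->
  derivable (fun s : R => v (s *: e + x)) t 1.
Proof. by rewrite /derivable line_growth_rate. Qed.

Lemma derive_along_line v x e :
  (fun t : R => 'D_1 (fun s : R => v (s *: e + x)) t) =
  (fun t : R => 'D_e v (t *: e + x)).
Proof. by apply/funext => t; rewrite /derive line_growth_rate. Qed.

Lemma derive2_max_le0 v x e :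
  (\forall y \near x, derivable v y e) -> derivable (fun y => 'D_e v y) x e ->
  (\forall y \near x, v y <= v x) -> 'D_e (fun y => 'D_e v y) x <= 0.
Proof.
move=> dv ddv mv.
have line0 : (fun t : R => t *: e + x) @ (0 : R) --> x.
  rewrite -[X in _ --> X]add0r -(scale0r e).
  by apply: cvgD; [exact: scalel_continuous|exact: cvg_cst].
rewrite derive_line -derive_along_line; apply: second_derive_le0.
- near=> t; apply: (@derivable_along_line v x e); near: t; exact: (line0 _ dv).
- rewrite derive_along_line.
  apply: (@derivable_along_line (fun y => 'D_e v y) x e).
  by rewrite scale0r add0r.
- near=> t; rewrite scale0r add0r; near: t; exact: (line0 _ mv).
Unshelve. all: by end_near. Qed.

Lemma sum_lin (I : finType) (c : R) (F G H : I -> R) :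
  (forall i, F i = G i + c * H i) -> \sum_i F i = \sum_i G i + c * \sum_i H i.
Proof. by move=> E; rewrite mulr_sumr -big_split; exact: eq_bigr. Qed.

(** Solving the problem includes being twice continuously differentiable: the
    partial derivatives of the sum are computed on a neighbourhood of each point
    in order to be differentiated once more. *)
Lemma poisson_neumann_lin (r1 r2 c q1 q2 : R) (f1 f2 : point3 R -> R) v1 v2 :
  poisson_neumann r1 r2 f1 q1 v1 -> poisson_neumann r1 r2 f2 q2 v2 ->
  poisson_neumann r1 r2 (fun x => f1 x + c * f2 x) (q1 + c * q2)
    (fun x => v1 x + c * v2 x).
Proof.
move=> [C1 cont1 L1 N1] [C2 cont2 L2 N2].
have dD x e w1 w2 : derivable w1 x e -> derivable w2 x e ->
    is_derive x e (fun y => w1 y + c * w2 y) ('D_e w1 x + c * 'D_e w2 x).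
  move=> /derivableP d1 /derivableP d2.
  by apply: is_derive_eq; rewrite /GRing.scale/=; ring.
have p1 x i : shell r1 r2 x ->
    is_derive x (basis_vec R i) (fun y => v1 y + c * v2 y)
      (partial i v1 x + c * partial i v2 x).
  move=> sx; have [_ /(_ i)[d1 _] _] := C1 x sx.
  by have [_ /(_ i)[d2 _] _] := C2 x sx; exact: dD.
have np1 x i : shell r1 r2 x -> \forall y \near x,
    partial i v1 y + c * partial i v2 y =
    partial i (fun y => v1 y + c * v2 y) y.
  move=> sx; near=> y.
  have sy : shell r1 r2 y by near: y; exact: near_shell.
  by have d := p1 y i sy; rewrite /partial derive_val.
have p2 x i j : shell r1 r2 x ->
    is_derive x (basis_vec R j) (partial i (fun y => v1 y + c * v2 y))
      (partial j (partial i v1) x + c * partial j (partial i v2) x).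
  move=> sx; apply: (near_eq_is_derive (np1 x i sx)).
  have [_ _ /(_ i j)[d1 _]] := C1 x sx; have [_ _ /(_ i j)[d2 _]] := C2 x sx.
  exact: dD.
have np2 x i j : shell r1 r2 x -> \forall y \near x,
    partial j (partial i v1) y + c * partial j (partial i v2) y =
    partial j (partial i (fun y => v1 y + c * v2 y)) y.
  move=> sx; near=> y.
  have sy : shell r1 r2 y by near: y; exact: near_shell.
  by have d := p2 y i j sy; rewrite [RHS]/partial derive_val.
split.
- move=> x sx; have [c1 d1 dd1] := C1 x sx; have [c2 d2 dd2] := C2 x sx; split.
  + by apply: cvgD => //; apply: cvgM => //; exact: cvg_cst.
  + move=> i; have d := p1 x i sx; split => //.
    apply: (near_eq_continuous (np1 x i sx)).
    apply: cvgD; first exact: (d1 i).2.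
    by apply: cvgM; [exact: cvg_cst|exact: (d2 i).2].
  + move=> i j; have d := p2 x i j sx; split => //.
    apply: (near_eq_continuous (np2 x i j sx)).
    apply: cvgD; [exact: (dd1 i j).2|].
    by apply: cvgM; [exact: cvg_cst|exact: (dd2 i j).2].
- move=> x; apply: cvgD; first exact: cont1.
  by apply: cvgM; [exact: cvg_cst|exact: cont2].
- move=> x sx; rewrite -L1// -L2//.
  have -> : laplacian (fun y => v1 y + c * v2 y) x =
      laplacian v1 x + c * laplacian v2 x.
    apply: sum_lin => i; exact: esym (nbhs_singleton (np2 x i i sx)).
  by rewrite opprD mulrN.
- move=> x sx; have [d1 nd1 <-] := N1 x sx; have [d2 nd2 <-] := N2 x sx.
  exists (d1 + c * d2); last by ring.
  rewrite /has_normal_derivative.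
  rewrite (_ : (fun t : R => _) = (fun t : R =>
    t^-1 * (v1 x - v1 (x - t *: outer_normal x)) +
    c * (t^-1 * (v2 x - v2 (x - t *: outer_normal x))))); last first.
    by apply/funext => t; ring.
  by apply: cvgD => //; apply: cvgM => //; exact: cvg_cst.
Unshelve. all: by end_near. Qed.

End MaximumPrinciple.

(** * Maximum principle *)

Section Uniqueness.
Context {R : realType}.
Implicit Types (x y n : point3 R) (v w : point3 R -> R).

Lemma compact_closed_shell (r1 r2 : R) : compact (@closed_shell R r1 r2).
Proof.
have coord_le (a b : R) : 0 <= b -> `|a| <= Num.sqrt (a ^+ 2 + b).
  by move=> b0; rewrite -sqrtr_sqr ler_wsqrtr// lerDl.
apply: (@subclosed_compact _ _
    ((`[- r2, r2] `*` `[- r2, r2]) `*` `[- r2, r2])).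
- rewrite (_ : closed_shell r1 r2 = (@enorm R) @^-1` `[r1, r2]); last first.
    by apply/seteqP; split => x /=; rewrite in_itv.
  apply: preimage_closed; last exact: itv_closed.
  by move=> x _; exact: enorm_continuous.
- by apply: compact_setX; [apply: compact_setX|]; exact: segment_compact.
- move=> [[a b] c] /andP[_ xr2] /=; rewrite !in_itv/= -!ler_norml.
  do !split; apply: le_trans xr2; rewrite /enorm/=.
  + by rewrite -addrA; apply: coord_le; rewrite addr_ge0// sqr_ge0.
  + rewrite [a ^+ 2 + _]addrC -addrA.
    by apply: coord_le; rewrite addr_ge0// sqr_ge0.
  + by rewrite addrC; apply: coord_le; rewrite addr_ge0// sqr_ge0.
Qed.

Lemma normal_derivative_ge0 v x n (d : R) :
  has_normal_derivative v x n d ->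
  (\forall t \near 0^'+, v (x - t *: n) <= v x) -> 0 <= d.
Proof.
move=> vd vmax; apply: (cvgr_to_ge vd).
near=> t; rewrite mulr_ge0 ?invr_ge0// ?subr_ge0//; near: t => //.
Unshelve. all: by end_near. Qed.

Lemma near_outer_normal (r1 r2 : R) x : 0 < r1 -> r1 < r2 -> sphere r2 x ->
  \forall t \near 0^'+, closed_shell r1 r2 (x - t *: outer_normal x).
Proof.
move=> r10 r12 xr2; have x0 : 0 < enorm x by rewrite xr2 (lt_trans r10).
near=> t.
have t0 : 0 < t by near: t; exact: nbhs_right_gt.
have tr : t < r2 - r1 by near: t; apply: nbhs_right_lt; rewrite subr_gt0.
have := @enorm_shift_normal R 1 t x x0.
rewrite scale1r mul1r -/(outer_normal x) xr2 => e.
by rewrite /closed_shell/= e; lra.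
Unshelve. all: by end_near. Qed.

Lemma near_inner_normal (r1 r2 : R) x : 0 < r1 -> r1 < r2 -> sphere r1 x ->
  \forall t \near 0^'+, closed_shell r1 r2 (x - t *: inner_normal x).
Proof.
move=> r10 r12 xr1; have x0 : 0 < enorm x by rewrite xr1.
near=> t.
have t0 : 0 < t by near: t; exact: nbhs_right_gt.
have tr : t < r2 - r1 by near: t; apply: nbhs_right_lt; rewrite subr_gt0.
have := @enorm_shift_normal R (-1) t x x0.
rewrite scaleN1r mulN1r opprK -/(inner_normal x) xr1 => e.
by rewrite /closed_shell/= e; lra.
Unshelve. all: by end_near. Qed.

Lemma laplacian_max_le0 (A : set (point3 R)) v x : is_C2 A v ->
  (\forall y \near x, A y) -> (\forall y \near x, v y <= v x) ->
  laplacian v x <= 0.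
Proof.
move=> C nA vmax; rewrite /laplacian; apply: sumr_le0 => i _.
have [_ _ /(_ i i)[ddv _]] := C x (nbhs_singleton nA).
apply: derive2_max_le0 => //.
near=> y; have [|_ /(_ i)[dv _] _] := C y; last exact: dv.
by near: y.
Unshelve. all: by end_near. Qed.

(** At an interior maximum the Laplacian would be nonpositive, and at a maximum
    on the outer sphere the outward derivative would be nonnegative; the signs
    of [f] and [q] exclude both. *)
Lemma max_on_inner_sphere (r1 r2 q : R) (f : point3 R -> R) v :
  0 < r1 -> r1 < r2 -> poisson_neumann r1 r2 f q v ->
  (forall x, shell r1 r2 x -> f x < 0) -> 0 < q ->
  exists2 x0, sphere r1 x0 & forall x, closed_shell r1 r2 x -> v x <= v x0.
Proof.
move=> r10 r12 [C cont L N] f0 q0.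
have ne : closed_shell r1 r2 !=set0.
  exists (r1, 0, 0); rewrite /closed_shell/enorm/= expr0n/= !addr0 sqrtr_sqr.
  by rewrite ger0_norm ?(ltW r10)// lexx ltW.
have [x0 x0A x0max] :=
  compact_EVT_max ne (@compact_closed_shell r1 r2) cont.
rewrite inE in x0A.
have {}x0max x : closed_shell r1 r2 x -> v x <= v x0.
  by move=> xA; apply: x0max; rewrite inE.
exists x0 => //; move: (x0A) => /andP[r1x xr2].
have [xr2'|nxr2] := eqVneq (enorm x0) r2.
  have [d nd dq] := N _ xr2'.
  have : 0 <= d.
    apply: (normal_derivative_ge0 nd); near=> t; apply: x0max; near: t.
    exact: near_outer_normal.
  by rewrite leNgt -oppr_gt0 dq q0.
have [//|nxr1] := eqVneq (enorm x0) r1.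
have sx : shell r1 r2 x0 by rewrite /shell/= !lt_neqAle eq_sym nxr1 r1x nxr2.
have : laplacian v x0 <= 0.
  apply: (laplacian_max_le0 C); first exact: near_shell.
  near=> x; apply: x0max.
  have /andP[? ?] : shell r1 r2 x by near: x; exact: near_shell.
  by apply/andP; split; exact: ltW.
by rewrite leNgt -oppr_lt0 L// f0.
Unshelve. all: by end_near. Qed.

End Uniqueness.

(** * Comparison and uniqueness *)

Section Comparison.
Context {R : realType}.
Implicit Types (x y n : point3 R) (v w : point3 R -> R).

(** The span of [1], [1/r], [r^2], [r] and [r^4] contains the radial states and
    adjoint states: [1] and [1/r] are the harmonic ones, [r^2] produces the
    constant sources, and [r] and [r^4] the sources [1/r] and [r^2] that a state
    contributes to the adjoint equation. *)
Definition rad (a0 a1 a2 a3 a4 t : R) : R :=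
  a0 + a1 / t + a2 * t ^+ 2 + a3 * t + a4 * t ^+ 4.

(** The derivative of [rad a0 a1 a2 a3 a4]. *)
Definition drad (a1 a2 a3 a4 t : R) : R :=
  - a1 / t ^+ 2 + 2 * a2 * t + a3 + 4 * a4 * t ^+ 3.

Lemma is_derive_exprV (n : nat) (t : R) : t != 0 ->
  is_derive t 1 (fun z : R => (z ^+ n)^-1)
    (- (t ^+ n) ^- 2 * (n%:R * t ^+ n.-1)).
Proof.
move=> t0; have tn0 : t ^+ n != 0 by rewrite expf_neq0.
have dn : is_derive t 1 (fun z : R => z ^+ n) (n%:R * t ^+ n.-1).
  have := @is_deriveX R R id n t 1 1 (is_derive_id t 1).
  by rewrite /GRing.scale/= mulr1 exprfctE.
exact: (@is_deriveV _ (fun z : R => z ^+ n) t _ 1 tn0 dn).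
Qed.

Lemma is_derive_rad a0 a1 a2 a3 a4 (t : R) : 0 < t ->
  is_derive t 1 (rad a0 a1 a2 a3 a4) (drad a1 a2 a3 a4 t).
Proof.
move=> t0; have tn0 : t != 0 by rewrite gt_eqF.
have d1 := is_derive_exprV 1 tn0.
rewrite /rad /drad; apply: is_derive_eq; rewrite /GRing.scale/=.
by field.
Qed.

Lemma poisson_neumann_eq (r1 r2 q1 q2 : R) (f1 f2 : point3 R -> R) v :
  poisson_neumann r1 r2 f1 q1 v -> (forall x, shell r1 r2 x -> f1 x = f2 x) ->
  q1 = q2 -> poisson_neumann r1 r2 f2 q2 v.
Proof.
by move=> [C cont L N] f12 <-; split => // x sx; rewrite L// f12.
Qed.

Lemma poisson_neumann_rad (r1 r2 a0 a1 a2 a3 a4 : R) : 0 < r1 -> r1 < r2 ->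
  poisson_neumann r1 r2
    (fun x => - (6 * a2 + 2 * a3 / enorm x + 20 * a4 * enorm x ^+ 2))
    (- drad a1 a2 a3 a4 r2) (fun x => rad a0 a1 a2 a3 a4 (enorm x)).
Proof.
move=> r10 r12; have r2n0 : r2 != 0 by rewrite gt_eqF// (lt_trans r10).
(* the profiles with rad' = t g and g' = t h *)
pose g t := - a1 / t ^+ 3 + 2 * a2 + a3 / t + 4 * a4 * t ^+ 2.
pose h t := 3 * a1 / t ^+ 5 - a3 / t ^+ 3 + 8 * a4.
apply: poisson_neumann_eq
  (@poisson_neumann_radial _ _ g h _ _ r10 r12 _ _ _) _ _.
- move=> t t0; have tn0 : t != 0 by rewrite gt_eqF.
  have dt := is_derive_rad a0 a1 a2 a3 a4 t0.
  by apply: is_derive_eq; rewrite /drad /g; field.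
- move=> t t0; have tn0 : t != 0 by rewrite gt_eqF.
  have d1 := is_derive_exprV 1 tn0; have d3 := is_derive_exprV 3 tn0.
  rewrite /g /h.
  by apply: is_derive_eq; rewrite /GRing.scale/=; field.
- move=> t t0; have tn0 : t != 0 by rewrite gt_eqF.
  have d3 := is_derive_exprV 3 tn0; have d5 := is_derive_exprV 5 tn0.
  have dh : is_derive t 1 h (- 15 * a1 / t ^+ 6 + 3 * a3 / t ^+ 4).
    by rewrite /h; apply: is_derive_eq; rewrite /GRing.scale/=; field.
  exact: is_derive_continuous dh.
- move=> x /andP[r1x _].
  have xn0 : enorm x != 0 by rewrite gt_eqF// (lt_trans r10).
  by rewrite /g /h; field.
- by rewrite /g /drad; field.
Qed.

(** The perturbation [phi = 1/r + k r^2] with [k = 1 / (4 r2^3)] is positive,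
    has Laplacian [6 k > 0] and radial derivative [- 1 / (2 r2^2) < 0] at [r2];
    so [w + e phi] attains its maximum at a point [x0] of the inner sphere.
    There its outward derivative is nonnegative, and [phi] contributes
    [- e phi'(r1)] to it: this is the premise of the last hypothesis, which
    states what an inner boundary condition has to provide. It bounds [w] by a
    multiple of [e], and [e] tends to [0]. *)
Lemma comparison (r1 r2 : R) (f : point3 R -> R) w :
  0 < r1 -> r1 < r2 -> poisson_neumann r1 r2 f 0 w ->
  (forall x, shell r1 r2 x -> f x = 0) ->
  (exists C : R, forall (e : R) (x0 : point3 R), 0 < e -> sphere r1 x0 ->
    (forall d : R, has_normal_derivative w x0 (inner_normal x0) d ->
       e * drad 1 ((4 * r2 ^+ 3)^-1) 0 0 r1 <= d) ->
    w x0 <= C * e) ->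
  forall x, closed_shell r1 r2 x -> w x <= 0.
Proof.
move=> r10 r12 wP f0 [C HC] x xA.
have r20 := lt_trans r10 r12; have r2n0 : r2 != 0 by rewrite gt_eqF.
pose k : R := (4 * r2 ^+ 3)^-1.
have k0 : 0 < k by rewrite invr_gt0 mulr_gt0// exprn_gt0.
pose phi (y : point3 R) := rad 0 1 k 0 0 (enorm y).
have phi0 y : closed_shell r1 r2 y -> 0 <= phi y.
  move=> /andP[r1y _]; have y0 := lt_le_trans r10 r1y.
  rewrite /phi /rad add0r !mul0r !addr0 addr_ge0//.
    by rewrite divr_ge0// ltW.
  by rewrite mulr_ge0 ?sqr_ge0// ltW.
have phiP := poisson_neumann_rad 0 1 k 0 0 r10 r12.
pose D := C + rad 0 1 k 0 0 r1.
have main e : 0 < e -> w x <= D * e.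
  move=> e0; have wphi := poisson_neumann_lin e wP phiP.
  have [||x0 x0s x0max] := max_on_inner_sphere r10 r12 wphi.
  - move=> y sy; rewrite f0// (_ : 0 + _ = - (e * (6 * k))); last by ring.
    by rewrite oppr_lt0 !mulr_gt0.
  - rewrite add0r mulr_gt0// oppr_gt0 /drad /k.
    rewrite (_ : - 1 / _ + _ + _ + _ = - (2 * r2 ^+ 2)^-1); last by field.
    by rewrite oppr_lt0 invr_gt0 mulr_gt0// exprn_gt0.
  have x0A : closed_shell r1 r2 x0.
    by rewrite /closed_shell/= x0s lexx ltW.
  have wx0 : w x0 <= C * e.
    apply: HC => // d nd.
    have dphi := @inner_normal_derivative_radial R (rad 0 1 k 0 0)
      (drad 1 k 0 0 r1) x0.
    rewrite x0s in dphi; have {}dphi := dphi r10 (is_derive_rad 0 1 k 0 0 r10).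
    rewrite -subr_ge0 -mulrN.
    apply: (@normal_derivative_ge0 R (fun y => w y + e * phi y) x0
      (inner_normal x0)).
      rewrite /has_normal_derivative.
      rewrite (_ : (fun t : R => _) = (fun t : R =>
        t^-1 * (w x0 - w (x0 - t *: inner_normal x0)) +
        e * (t^-1 * (phi x0 - phi (x0 - t *: inner_normal x0))))); last first.
        by apply/funext => t; ring.
      by apply: cvgD => //; apply: cvgM => //; exact: cvg_cst.
    near=> t; apply: x0max; near: t; exact: near_inner_normal.
  have := x0max x xA; rewrite x0s => wx.
  rewrite /D mulrDl -subr_ge0.
  have : 0 <= e * phi x by rewrite mulr_ge0 ?phi0// ltW.
  rewrite /phi; move: wx wx0; rewrite /phi; lra.
(* if w x were positive, e = w x / (2 (|D| + 1)) would be too small *)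
rewrite leNgt; apply/negP => wx0.
have n0 : 0 < `|D| + 1 by rewrite ltr_wpDl.
have := main (w x / (`|D| + 1) / 2); rewrite !divr_gt0// => /(_ isT).
apply/negP; rewrite -ltNge.
have Dn : D / (`|D| + 1) < 1.
  by rewrite ltr_pdivrMr// mul1r (le_lt_trans (ler_norm _))// ltrDl.
rewrite (_ : D * _ = D / (`|D| + 1) * (w x / 2)); last by ring.
apply: (@le_lt_trans _ _ (1 * (w x / 2))); last by lra.
by rewrite ler_wpM2r// ltW// divr_gt0.
Unshelve. all: by end_near. Qed.

Lemma dirichlet_unique (r1 r2 b q : R) (f1 f2 : point3 R -> R) v1 v2 :
  0 < r1 -> r1 < r2 ->
  dirichlet_problem r1 r2 f1 b q v1 -> dirichlet_problem r1 r2 f2 b q v2 ->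
  (forall x, shell r1 r2 x -> f1 x = f2 x) ->
  forall x, closed_shell r1 r2 x -> v1 x = v2 x.
Proof.
move=> r10 r12 + + + x xA.
wlog suff main : f1 f2 v1 v2 / dirichlet_problem r1 r2 f1 b q v1 ->
    dirichlet_problem r1 r2 f2 b q v2 ->
    (forall x, shell r1 r2 x -> f1 x = f2 x) -> v1 x <= v2 x.
  move=> d1 d2 f12; apply/eqP; rewrite eq_le (main f1 f2)// (main f2 f1)//.
  by move=> y sy; rewrite f12.
move=> [P1 B1] [P2 B2] f12; rewrite -subr_le0 -[- v2 x]mulN1r.
have wP : poisson_neumann r1 r2 (fun=> 0) 0 (fun x => v1 x + -1 * v2 x).
  apply: poisson_neumann_eq (poisson_neumann_lin (-1) P1 P2) _ _.
    by move=> y sy; rewrite f12// mulN1r subrr.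
  by rewrite mulN1r subrr.
apply: (comparison r10 r12 wP) xA => //.
exists 0 => e x0 e0 x0s _.
by rewrite B1// B2// mulN1r subrr mul0r.
Qed.

Lemma robin_unique (r1 r2 alpha b q : R) (f1 f2 : point3 R -> R) v1 v2 :
  0 < r1 -> r1 < r2 -> 0 < alpha ->
  robin_problem r1 r2 alpha f1 b q v1 -> robin_problem r1 r2 alpha f2 b q v2 ->
  (forall x, shell r1 r2 x -> f1 x = f2 x) ->
  forall x, closed_shell r1 r2 x -> v1 x = v2 x.
Proof.
move=> r10 r12 alpha0 + + + x xA.
wlog suff main : f1 f2 v1 v2 / robin_problem r1 r2 alpha f1 b q v1 ->
    robin_problem r1 r2 alpha f2 b q v2 ->
    (forall x, shell r1 r2 x -> f1 x = f2 x) -> v1 x <= v2 x.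
  move=> d1 d2 f12; apply/eqP; rewrite eq_le (main f1 f2)// (main f2 f1)//.
  by move=> y sy; rewrite f12.
move=> [P1 B1] [P2 B2] f12; rewrite -subr_le0 -[- v2 x]mulN1r.
have wP : poisson_neumann r1 r2 (fun=> 0) 0 (fun x => v1 x + -1 * v2 x).
  apply: poisson_neumann_eq (poisson_neumann_lin (-1) P1 P2) _ _.
    by move=> y sy; rewrite f12// mulN1r subrr.
  by rewrite mulN1r subrr.
apply: (comparison r10 r12 wP) xA => //.
exists (- drad 1 ((4 * r2 ^+ 3)^-1) 0 0 r1 / alpha) => e x0 e0 x0s Hd.
have [d1 n1 e1] := B1 _ x0s; have [d2 n2 e2] := B2 _ x0s.
have nd : has_normal_derivative (fun x => v1 x + -1 * v2 x) x0
    (inner_normal x0) (d1 - d2).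
  rewrite /has_normal_derivative.
  rewrite (_ : (fun t : R => _) = (fun t : R =>
    t^-1 * (v1 x0 - v1 (x0 - t *: inner_normal x0)) -
    (t^-1 * (v2 x0 - v2 (x0 - t *: inner_normal x0))))); last first.
    by apply/funext => t; ring.
  exact: cvgB.
have ed := Hd _ nd; rewrite mulrAC ler_pdivlMr//.
have : alpha * (v1 x0 - b) - alpha * (v2 x0 - b) = - d1 + d2.
  by rewrite -e1 -e2 opprK.
by move: ed; lra.
Qed.

End Comparison.

(** * Integrals of radial functions over the shell *)

Section ShellIntegrals.
Context {R : realType}.
Notation leb := (@lebesgue_measure R).
Notation vol := ((leb \x leb) \x leb)%E.
(* the sigma-algebra on which the product Lebesgue measure is defined *)
Notation borel3 :=
  (measurableTypeR R * measurableTypeR R * measurableTypeR R)%type.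
Implicit Types (x : point3 R) (f g : R -> R).

Lemma measurable_sqr_enorm :
  measurable_fun [set: borel3]
    (fun x : point3 R => x.1.1 ^+ 2 + x.1.2 ^+ 2 + x.2 ^+ 2).
Proof.
apply: measurable_funD; first apply: measurable_funD.
- apply: measurable_funX; apply: measurableT_comp; first exact: measurable_fst.
  exact: measurable_fst.
- apply: measurable_funX; apply: measurableT_comp; first exact: measurable_snd.
  exact: measurable_fst.
- by apply: measurable_funX; exact: measurable_snd.
Qed.

Lemma measurable_enorm : measurable_fun [set: borel3] (@enorm R).
Proof.
rewrite (_ : @enorm R = Num.sqrt \o
  (fun x : point3 R => x.1.1 ^+ 2 + x.1.2 ^+ 2 + x.2 ^+ 2))//.
apply: measurableT_comp; last exact: measurable_sqr_enorm.
by apply: continuous_measurable_fun; exact: sqrt_continuous.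
Qed.

Lemma measurable_shell (r1 r2 : R) : measurable (@shell R r1 r2 : set borel3).
Proof.
have -> : shell r1 r2 = setT `&` (@enorm R) @^-1` `]r1, r2[.
  by rewrite setTI; apply/seteqP; split => x /=; rewrite in_itv.
exact: measurable_enorm.
Qed.

Lemma volume_shell (r1 r2 : R) : 0 <= r1 -> r1 < r2 ->
  vol (shell r1 r2) = (4 / 3 * pi * (r2 ^+ 3 - r1 ^+ 3))%:E.
Proof.
move=> r10 r12; have r20 : 0 <= r2 by rewrite (le_trans r10)// ltW.
pose B (b : bool) (t : R) : set (point3 R) :=
  [set x | x.1.1 ^+ 2 + x.1.2 ^+ 2 + x.2 ^+ 2 < t ?<= if b].
have mB b t : measurable (B b t : set borel3).
  by apply: measurable_lteif; exact: measurable_sqr_enorm.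
have volB b t : 0 <= t -> vol (B b t) = (4 / 3 * pi * Num.sqrt t ^+ 3)%:E.
  exact: volume_ball.
have sq x : x.1.1 ^+ 2 + x.1.2 ^+ 2 + x.2 ^+ 2 = enorm x ^+ 2.
  by rewrite -dotxx /dot -!expr2.
have -> : shell r1 r2 = B false (r2 ^+ 2) `\` B true (r1 ^+ 2).
  apply/seteqP; split => x; rewrite /B /shell/= !sq.
    by move=> /andP[r1x xr2]; rewrite ltr_sqr ?nnegrE// ?enorm_ge0// xr2;
      split => //; apply/negP; rewrite -ltNge ltr_sqr ?nnegrE// enorm_ge0.
  move=> [xr2 /negP]; rewrite -ltNge => r1x; apply/andP; split.
    by rewrite -ltr_sqr ?nnegrE// enorm_ge0.
  by rewrite -ltr_sqr ?nnegrE// enorm_ge0.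
have Boo : (vol (B false (r2 ^+ 2)%R) < +oo)%E by rewrite volB ?sqr_ge0// ltry.
rewrite (measureD (mB _ _) (mB _ _) Boo)/=.
have -> : B false (r2 ^+ 2) `&` B true (r1 ^+ 2) = B true (r1 ^+ 2).
  apply/setIidPr => x; rewrite /B/= => xr1; apply: (le_lt_trans xr1).
  by rewrite ltr_sqr ?nnegrE.
rewrite !volB ?sqr_ge0// !sqrtr_sqr !ger0_norm// -EFinB.
by congr EFin; ring.
Qed.

Definition shell_integral (r1 r2 : R) f : R :=
  \int[vol]_(x in shell r1 r2) f (enorm x).

Lemma integrable_radial (r1 r2 : R) f : 0 < r1 -> r1 < r2 ->
  (forall t : R, 0 < t -> {for t, continuous f}) ->
  vol.-integrable (shell r1 r2) (EFin \o (fun x => f (enorm x))).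
Proof.
move=> r10 r12 cf.
have Soo : (vol (shell r1 r2) < +oo)%E by rewrite volume_shell ?ltry// ltW.
apply: measurable_bounded_integrable => //; first exact: measurable_shell.
- apply: (@measurable_comp _ _ _ _ _ _ `]r1, r2[ f _ (@enorm R)).
  + exact: measurable_itv.
  + by move=> _ [x /= sx <-]; rewrite /= in_itv.
  + apply: open_continuous_measurable_fun; first exact: interval_open.
    move=> t; rewrite inE/= in_itv/= => /andP[r1t _].
    by apply: cf; exact: lt_trans r1t.
  + apply: measurable_funTS; exact: measurable_enorm.
- have cff : {within `[r1, r2], continuous f}.
    apply: continuous_in_subspaceT => t; rewrite inE/= in_itv/= => /andP[r1t _].
    by apply: cf; exact: lt_le_trans r1t.
  have /compact_bounded[M [Mreal HM]] :=
    continuous_compact cff (@segment_compact _ r1 r2).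
  exists M; split => // M' MM' x /= /andP[r1x xr2]; apply: (HM _ MM').
  by exists (enorm x) => //=; rewrite in_itv/= !ltW.
Qed.

Lemma integral_radial (r1 r2 : R) f : 0 < r1 -> r1 < r2 ->
  (forall t : R, 0 < t -> {for t, continuous f}) ->
  (\int[vol]_(x in shell r1 r2) (f (enorm x))%:E)%E =
    (shell_integral r1 r2 f)%:E.
Proof.
move=> r10 r12 cf; rewrite /shell_integral /Rintegral fineK//.
apply: integrable_fin_num; first exact: measurable_shell.
exact: integrable_radial.
Qed.

Lemma shell_integral_sqr_ge0 (r1 r2 : R) f :
  0 <= shell_integral r1 r2 (fun t => f t ^+ 2).
Proof. by apply: Rintegral_ge0 => x _; exact: sqr_ge0. Qed.

Lemma continuous_sqr f (t : R) : {for t, continuous f} ->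
  {for t, continuous (fun s => f s ^+ 2)}.
Proof. by move=> cf; exact: (continuous_comp cf (@exprn_continuous R 2 _)). Qed.

Lemma L2norm_eq (A : set (point3 R)) (v w : point3 R -> R) :
  (forall x, A x -> v x ^+ 2 = w x ^+ 2) -> L2norm A v = L2norm A w.
Proof.
move=> vw; rewrite /L2norm; congr sqrte; apply: eq_integral => x.
by rewrite inE => Ax; rewrite vw.
Qed.

Lemma L2norm_radial (r1 r2 : R) f : 0 < r1 -> r1 < r2 ->
  (forall t : R, 0 < t -> {for t, continuous f}) ->
  L2norm (shell r1 r2) (fun x => f (enorm x)) =
    (Num.sqrt (shell_integral r1 r2 (fun t => f t ^+ 2)))%:E.
Proof.
move=> r10 r12 cf; rewrite /L2norm.
rewrite (@integral_radial r1 r2 (fun t => f t ^+ 2))//.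
by move=> t t0; apply/continuous_sqr/cf.
Qed.

Lemma shell_integral_cst (r1 r2 c : R) : 0 <= r1 -> r1 < r2 ->
  shell_integral r1 r2 (fun=> c) = c * (4 / 3 * pi * (r2 ^+ 3 - r1 ^+ 3)).
Proof.
move=> r10 r12.
rewrite /shell_integral Rintegral_cst; last exact: measurable_shell.
by congr (_ * _); rewrite -[RHS]/(fine (_%:E)) -(volume_shell r10 r12).
Qed.

Lemma shell_integral_sqr_addc (r1 r2 s : R) f : 0 < r1 -> r1 < r2 ->
  (forall t : R, 0 < t -> {for t, continuous f}) ->
  shell_integral r1 r2 (fun t => (f t + s) ^+ 2) =
    shell_integral r1 r2 (fun t => f t ^+ 2) +
    2 * s * shell_integral r1 r2 f +
    s ^+ 2 * (4 / 3 * pi * (r2 ^+ 3 - r1 ^+ 3)).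
Proof.
move=> r10 r12 cf; have mS := @measurable_shell r1 r2.
have i1 : vol.-integrable (shell r1 r2) (EFin \o (fun x => f (enorm x))).
  exact: integrable_radial.
have i2 : vol.-integrable (shell r1 r2) (EFin \o (fun x => f (enorm x) ^+ 2)).
  apply: (@integrable_radial r1 r2 (fun t => f t ^+ 2)) => // t t0.
  exact/continuous_sqr/cf.
have i3 : vol.-integrable (shell r1 r2)
    (EFin \o (fun x => 2 * s * f (enorm x))).
  apply: (@integrable_radial r1 r2 (fun t => 2 * s * f t)) => // t t0.
  by apply: cvgM; [exact: cvg_cst|exact: cf].
have i4 : vol.-integrable (shell r1 r2) (EFin \o (fun=> s ^+ 2)).
  apply: (@integrable_radial r1 r2 (fun=> s ^+ 2)) => // t t0.
  exact: cvg_cst.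
have i12 : vol.-integrable (shell r1 r2)
    (EFin \o (fun x => f (enorm x) ^+ 2 + 2 * s * f (enorm x))).
  apply: (@integrable_radial r1 r2
    (fun t => f t ^+ 2 + 2 * s * f t)) => // t t0.
  apply: cvgD; first exact/continuous_sqr/cf.
  by apply: cvgM; [exact: cvg_cst|exact: cf].
rewrite -(shell_integral_cst _ (ltW r10) r12) /shell_integral -RintegralZl//.
rewrite -RintegralD// -RintegralD//.
by apply: eq_Rintegral => x _; ring.
Qed.

Lemma shell_integralZ (r1 r2 c : R) f : 0 < r1 -> r1 < r2 ->
  (forall t : R, 0 < t -> {for t, continuous f}) ->
  shell_integral r1 r2 (fun t => c * f t) = c * shell_integral r1 r2 f.
Proof.
move=> r10 r12 cf; rewrite /shell_integral RintegralZl//.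
  exact: measurable_shell.
exact: integrable_radial.
Qed.

(** Near [t0] the square exceeds half of its value [f t0 ^+ 2], hence on a thin
    shell, which has positive volume. *)
Lemma shell_integral_sqr_gt0 (r1 r2 t0 : R) f : 0 < r1 -> r1 < r2 ->
  (forall t : R, 0 < t -> {for t, continuous f}) ->
  r1 < t0 < r2 -> f t0 != 0 -> 0 < shell_integral r1 r2 (fun t => f t ^+ 2).
Proof.
move=> r10 r12 cf /andP[r1t0 t0r2] ft0.
have t00 := lt_trans r10 r1t0.
have cf2 t : 0 < t -> {for t, continuous (fun t => f t ^+ 2)}.
  by move=> tp; apply/continuous_sqr/cf.
pose d := f t0 ^+ 2 / 2.
have d0 : 0 < d by rewrite divr_gt0// lt_neqAle eq_sym sqrf_eq0 ft0 sqr_ge0.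
have : \forall t \near t0, d < f t ^+ 2.
  by apply: (cvgr_gt _ (cf2 _ t00)); rewrite /d; move: d0; rewrite /d; lra.
move=> /nbhs_ballP[e /= e0 He].
pose a := Num.max r1 (t0 - e); pose b := Num.min r2 (t0 + e).
have r1a : r1 <= a by rewrite le_max lexx.
have br2 : b <= r2 by rewrite ge_min lexx.
have at0 : a < t0 by rewrite gt_max r1t0 gtrBl.
have t0b : t0 < b by rewrite lt_min t0r2 ltrDl.
have ab := lt_trans at0 t0b.
have a0 : 0 <= a by rewrite (le_trans (ltW r10)).
have sub : shell a b `<=` @shell R r1 r2.
  move=> x /andP[ax xb]; apply/andP; split.
    exact: le_lt_trans ax.
  exact: lt_le_trans br2.
rewrite -lte_fin -integral_radial//.
apply: (@lt_le_trans _ _ (d%:E * vol (shell a b))%E).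
  rewrite (volume_shell a0 ab) -EFinM lte_fin.
  apply: mulr_gt0 => //; apply: mulr_gt0.
    by rewrite !mulr_gt0 ?pi_gt0 ?invr_gt0.
  by rewrite subr_gt0 ltrXn2r.
have mS2 : measurable_fun (shell r1 r2) (fun x => (f (enorm x) ^+ 2)%:E).
  have /integrableP[+ _] := integrable_radial r10 r12 cf2; exact.
rewrite -integral_cst; last exact: measurable_shell.
apply: (@le_trans _ _ (\int[vol]_(x in shell a b) (f (enorm x) ^+ 2)%:E)%E).
  apply: ge0_le_integral; first exact: measurable_shell.
  - by move=> x _; rewrite /= lee_fin ltW.
  - exact: measurable_cst.
  - by apply: measurable_funS sub mS2; exact: measurable_shell.
  - move=> x /andP[ax xb]; rewrite lee_fin; apply/ltW/He.
    rewrite -ball_normE/= ltr_distlC.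
    move: ax xb; rewrite gt_max lt_min => /andP[_ ax] /andP[_ xb].
    by rewrite ax xb.
apply: ge0_subset_integral => //.
- exact: measurable_shell.
- exact: measurable_shell.
- by move=> x _; rewrite lee_fin sqr_ge0.
Qed.

End ShellIntegrals.

(** * Norms and boundary conditions of the radial family *)

Section RadialSolutions.
Context {R : realType}.
Implicit Types (x : point3 R) (v w : point3 R -> R).

Lemma rad_continuous (a0 a1 a2 a3 a4 t : R) : 0 < t ->
  {for t, continuous (rad a0 a1 a2 a3 a4)}.
Proof.
by move=> t0; exact: is_derive_continuous (is_derive_rad _ _ _ _ _ t0).
Qed.

Lemma drad_continuous (a1 a2 a3 a4 t : R) : 0 < t ->
  {for t, continuous (drad a1 a2 a3 a4)}.
Proof.
move=> t0; have tn0 : t != 0 by rewrite gt_eqF.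
have d2 := is_derive_exprV 2 tn0.
have dd : is_derive t 1 (drad a1 a2 a3 a4)
    (2 * a1 / t ^+ 3 + 2 * a2 + 12 * a4 * t ^+ 2).
  by rewrite /drad; apply: is_derive_eq; rewrite /GRing.scale/=; field.
exact: is_derive_continuous dd.
Qed.

Lemma sqr_enorm_grad_rad (a0 a1 a2 a3 a4 : R) x : 0 < enorm x ->
  enorm (grad (fun y => rad a0 a1 a2 a3 a4 (enorm y)) x) ^+ 2 =
  drad a1 a2 a3 a4 (enorm x) ^+ 2.
Proof.
move=> x0; pose h (t : R) := drad a1 a2 a3 a4 t / t.
have dh (t : R) : 0 < t -> is_derive t 1 (rad a0 a1 a2 a3 a4) (t * h t).
  move=> t0; have tn0 : t != 0 by rewrite gt_eqF.
  have dt := is_derive_rad a0 a1 a2 a3 a4 t0.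
  by apply: is_derive_eq; rewrite /h; field.
rewrite (enorm_grad_radial dh x0) /h exprMn real_normK ?num_real//.
by field; rewrite gt_eqF.
Qed.

Lemma near_eq_grad v w x : (\forall y \near x, v y = w y) ->
  grad v x = grad w x.
Proof. by move=> vw; rewrite /grad /partial !(near_eq_derive _ vw). Qed.

Lemma L2norm_rad (r1 r2 a0 a1 a2 a3 a4 : R) w : 0 < r1 -> r1 < r2 ->
  (forall x, shell r1 r2 x -> w x = rad a0 a1 a2 a3 a4 (enorm x)) ->
  L2norm (shell r1 r2) w =
  (Num.sqrt (shell_integral r1 r2 (fun t => rad a0 a1 a2 a3 a4 t ^+ 2)))%:E.
Proof.
move=> r10 r12 wE; rewrite -L2norm_radial//; last first.
  by move=> t t0; exact: rad_continuous.
by apply: L2norm_eq => x sx; rewrite wE.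
Qed.

Lemma H1norm_rad (r1 r2 a0 a1 a2 a3 a4 : R) w : 0 < r1 -> r1 < r2 ->
  (forall x, shell r1 r2 x -> w x = rad a0 a1 a2 a3 a4 (enorm x)) ->
  H1norm (shell r1 r2) w =
  (Num.sqrt (shell_integral r1 r2 (fun t => rad a0 a1 a2 a3 a4 t ^+ 2) +
             shell_integral r1 r2 (fun t => drad a1 a2 a3 a4 t ^+ 2)))%:E.
Proof.
move=> r10 r12 wE; rewrite /H1norm (L2norm_rad r10 r12 wE).
rewrite (@L2norm_eq _ _ _ (fun x => drad a1 a2 a3 a4 (enorm x))); last first.
  move=> x sx; rewrite -(sqr_enorm_grad_rad a0); last first.
    by move: sx => /andP[r1x _]; exact: lt_trans r1x.
  congr (enorm _ ^+ 2); apply: near_eq_grad; near=> y; apply: wE.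
  by near: y; exact: near_shell.
rewrite L2norm_radial//; last by move=> t t0; exact: drad_continuous.
by rewrite -!EFin_expe !sqr_sqrtr ?shell_integral_sqr_ge0.
Unshelve. all: by end_near. Qed.

Lemma dirichlet_rad (r1 r2 a0 a1 a2 a3 a4 b q : R) (f : point3 R -> R) :
  0 < r1 -> r1 < r2 ->
  (forall x, shell r1 r2 x ->
    - (6 * a2 + 2 * a3 / enorm x + 20 * a4 * enorm x ^+ 2) = f x) ->
  - drad a1 a2 a3 a4 r2 = q -> rad a0 a1 a2 a3 a4 r1 = b ->
  dirichlet_problem r1 r2 f b q (fun x => rad a0 a1 a2 a3 a4 (enorm x)).
Proof.
move=> r10 r12 fE qE bE; split; last by move=> x ->.
exact: poisson_neumann_eq (poisson_neumann_rad _ _ _ _ _ r10 r12) fE qE.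
Qed.

Lemma robin_rad (r1 r2 alpha a0 a1 a2 a3 a4 b q : R) (f : point3 R -> R) :
  0 < r1 -> r1 < r2 ->
  (forall x, shell r1 r2 x ->
    - (6 * a2 + 2 * a3 / enorm x + 20 * a4 * enorm x ^+ 2) = f x) ->
  - drad a1 a2 a3 a4 r2 = q ->
  drad a1 a2 a3 a4 r1 = alpha * (rad a0 a1 a2 a3 a4 r1 - b) ->
  robin_problem r1 r2 alpha f b q (fun x => rad a0 a1 a2 a3 a4 (enorm x)).
Proof.
move=> r10 r12 fE qE bE; split.
  exact: poisson_neumann_eq (poisson_neumann_rad _ _ _ _ _ r10 r12) fE qE.
move=> x xr1; exists (- drad a1 a2 a3 a4 r1); last by rewrite opprK xr1.
apply: inner_normal_derivative_radial; rewrite xr1//.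
exact: is_derive_rad.
Qed.

Lemma cvg_sqrt_quadratic (a b c : R) :
  Num.sqrt (a + b * alpha^-1 + c * alpha^-1 ^+ 2) @[alpha --> +oo] -->
  Num.sqrt a.
Proof.
have inv0 : alpha^-1 @[alpha --> +oo] --> (0 : R).
  by apply/gtr0_cvgV0; [exact: nbhs_pinfty_gt|exact: cvg_id].
have lim : a + b * alpha^-1 + c * alpha^-1 ^+ 2 @[alpha --> +oo] -->
    a + b * 0 + c * 0 ^+ 2.
  apply: cvgD; first apply: cvgD.
  - exact: cvg_cst.
  - by apply: cvgM; [exact: cvg_cst|exact: inv0].
  - apply: cvgM; first exact: cvg_cst.
    apply: (@cvg_comp _ _ _ _ (fun z : R => z ^+ 2) _ _ _ inv0).
    exact: exprn_continuous.
rewrite (_ : a + b * 0 + c * 0 ^+ 2 = a) in lim; last by ring.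
by apply: (cvg_comp _ _ lim); exact: sqrt_continuous.
Qed.

End RadialSolutions.

(** * Explicit states and adjoint states *)

Section ExplicitSolutions.
Context {R : realType}.
Context (r1 r2 g q b zd : R) (r10 : 0 < r1) (r12 : r1 < r2).

Let r1n0 : r1 != 0. Proof. by rewrite gt_eqF. Qed.
Let r2n0 : r2 != 0. Proof. by rewrite gt_eqF// (lt_trans r10). Qed.

Let shell_neq0 (x : point3 R) : shell r1 r2 x -> enorm x != 0.
Proof. by move=> /andP[r1x _]; rewrite gt_eqF// (lt_trans r10). Qed.

(** [state0 + state1 / r - g r^2 / 6] is the radial solution of the Dirichlet
    problem for the state, and [slope_u] its radial derivative at [r1]. *)
Definition state1 := q * r2 ^+ 2 - g * r2 ^+ 3 / 3.
Definition state0 := b - state1 / r1 + g * r1 ^+ 2 / 6.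
Definition slope_u := drad state1 (- g / 6) 0 0 r1.

(** [rad adj0 adj1 adj2 adj3 adj4] is the radial solution of the Dirichlet
    problem for the adjoint state: the coefficients [adj2], [adj3] and [adj4]
    match the source [u - zd], [adj1] the flux at [r2] and [adj0] the value at
    [r1]. *)
Definition adj2 := - (state0 - zd) / 6.
Definition adj3 := - state1 / 2.
Definition adj4 := g / 120.
Definition adj1 := r2 ^+ 2 * (2 * adj2 * r2 + adj3 + 4 * adj4 * r2 ^+ 3).
Definition adj0 := - (adj1 / r1 + adj2 * r1 ^+ 2 + adj3 * r1 + adj4 * r1 ^+ 4).
Definition slope_p := drad adj1 adj2 adj3 adj4 r1.

(** [psi = psi0 + psi1 / r - r^2 / 6] solves [- Laplacian psi = 1] with
    [psi(r1) = 0] and [psi'(r2) = 0]. It is the response of the adjoint state to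
    a constant increment of the state. *)
Definition psi1 := - r2 ^+ 3 / 3.
Definition psi0 := - (psi1 / r1 - r1 ^+ 2 / 6).
Definition slope_psi := drad psi1 (- 1 / 6) 0 0 r1.

Lemma slope_uE :
  slope_u = - (3 * q * r2 ^+ 2 + g * (r1 ^+ 3 - r2 ^+ 3)) / (3 * r1 ^+ 2).
Proof. by rewrite /slope_u /drad /state1; field. Qed.

Lemma dirichlet_state : dirichlet_problem r1 r2 (fun=> g) b q
  (fun x => rad state0 state1 (- g / 6) 0 0 (enorm x)).
Proof.
apply: dirichlet_rad => //.
- by move=> x /shell_neq0 xn0; field.
- by rewrite /drad /state1; field.
- by rewrite /rad /state0 /state1; field.
Qed.

(** Adding a constant to the Dirichlet solution does not change the inner flux,
    so the Robin condition only fixes the constant. *)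
Lemma robin_state (alpha : R) : alpha != 0 ->
  robin_problem r1 r2 alpha (fun=> g) b q
    (fun x => rad (state0 + slope_u / alpha) state1 (- g / 6) 0 0 (enorm x)).
Proof.
move=> alphan0; apply: robin_rad => //.
- by move=> x /shell_neq0 xn0; field.
- by rewrite /drad /state1; field.
- by rewrite -/slope_u /rad /state0; field; rewrite r1n0.
Qed.

Lemma dirichlet_adjoint (f : point3 R -> R) :
  (forall x, shell r1 r2 x ->
    f x = rad state0 state1 (- g / 6) 0 0 (enorm x) - zd) ->
  dirichlet_problem r1 r2 f 0 0
    (fun x => rad adj0 adj1 adj2 adj3 adj4 (enorm x)).
Proof.
move=> fE; apply: dirichlet_rad => //.
- move=> x sx; have := shell_neq0 sx; rewrite fE// /rad /adj2 /adj3 /adj4.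
  by move=> xn0; field.
- by rewrite /drad /adj1; field.
- by rewrite /rad /adj0; ring.
Qed.

(** The state increment [slope_u / alpha] changes the adjoint state by
    [slope_u psi / alpha] and its derivative at [r1] by
    [slope_u slope_psi / alpha]; the remaining constant is the new derivative at
    [r1] divided by [alpha], as the Robin condition requires. *)
Lemma robin_adjoint (alpha : R) (f : point3 R -> R) : alpha != 0 ->
  (forall x, shell r1 r2 x ->
    f x = rad (state0 + slope_u / alpha) state1 (- g / 6) 0 0 (enorm x) - zd) ->
  robin_problem r1 r2 alpha f 0 0
    (fun x => rad
      (adj0 + (slope_p + slope_u * psi0 + slope_u * slope_psi / alpha) / alpha)
      (adj1 + slope_u * psi1 / alpha) (adj2 - slope_u / 6 / alpha) adj3 adj4
      (enorm x)).
Proof.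
move=> alphan0 fE; apply: robin_rad => //.
- move=> x sx; have := shell_neq0 sx; rewrite fE// /rad /adj2 /adj3 /adj4.
  by move=> xn0; field; rewrite xn0.
- rewrite /drad /adj1 /psi1; move: slope_u adj2 adj3 adj4 => D P2 P3 P4.
  by field; rewrite alphan0.
- transitivity (slope_p + slope_u * slope_psi / alpha).
    rewrite /slope_p /slope_psi /drad.
    move: slope_u adj1 adj2 adj3 adj4 => D P1 P2 P3 P4.
    by field; rewrite ?r1n0 ?alphan0.
  rewrite /rad /adj0 /psi0.
  move: slope_p slope_u slope_psi adj1 adj2 adj3 adj4 => DP D DS P1 P2 P3 P4.
  by field; rewrite ?r1n0 ?alphan0.
Qed.

(** [slope_p + slope_u psi], the limit of [alpha (p_alpha - p)]. *)
Definition limit_profile : R -> R :=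
  rad (slope_p + slope_u * psi0) (slope_u * psi1) (- slope_u / 6) 0 0.

Definition profile_slope : R -> R :=
  drad (slope_u * psi1) (- slope_u / 6) 0 0.

(** Where the profile vanishes on an interval, so does its derivative
    [slope_u psi'], and [psi'(t) = (r2^3 - t^3) / (3 t^2)] is positive in the
    shell; hence [slope_u = 0], and the profile is the constant [slope_p]. *)
Lemma limit_profile_neq0 : (slope_u != 0) || (slope_p != 0) ->
  exists2 t, r1 < t < r2 & limit_profile t != 0.
Proof.
pose t0 := (r1 + r2) / 2.
have t0I : r1 < t0 < r2 by rewrite /t0 !midf_lt.
move=> dn0; apply/not_exists2P => H0.
have {}H0 t : r1 < t < r2 -> limit_profile t = 0.
  by move=> tI; have [//|/negP/negPn/eqP] := H0 t.
have t00 : 0 < t0 by move: t0I r10; lra.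
have t0n0 : t0 != 0 by rewrite gt_eqF.
have dH := is_derive_rad (slope_p + slope_u * psi0) (slope_u * psi1)
  (- slope_u / 6) 0 0 t00.
have nH0 : \forall t \near t0, (cst 0 : R -> R) t = limit_profile t.
  near=> t; rewrite H0//; apply/andP; split.
    by near: t; apply: lt_nbhsr; case/andP: t0I.
  by near: t; apply: lt_nbhsl; case/andP: t0I.
have d0 : drad (slope_u * psi1) (- slope_u / 6) 0 0 t0 = 0.
  have dc : is_derive t0 1 limit_profile 0.
    by apply: near_eq_is_derive nH0 _; exact: is_derive_cst.
  rewrite -(derive_val (is_derive := dH)).
  by rewrite -[RHS](derive_val (is_derive := dc)).
have r2t0 : 0 < r2 ^+ 3 - t0 ^+ 3.
  have /andP[_ t0r2] := t0I.
  by rewrite subr_gt0 ltrXn2r ?nnegrE// ltW// (lt_trans t00).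
have du0 : slope_u = 0.
  have : slope_u * (r2 ^+ 3 - t0 ^+ 3) = 0.
    transitivity (3 * t0 ^+ 2 * drad (slope_u * psi1) (- slope_u / 6) 0 0 t0).
      by rewrite /drad /psi1; field.
    by rewrite d0 mulr0.
  by move/eqP; rewrite mulf_eq0 (gt_eqF r2t0) orbF => /eqP.
move: dn0 (H0 _ t0I); rewrite /limit_profile du0 eqxx/= /rad.
rewrite (_ : _ + _ = slope_p); last by ring.
by move=> /eqP.
Unshelve. all: by end_near. Qed.

Let shell_closed (x : point3 R) : shell r1 r2 x -> closed_shell r1 r2 x.
Proof. by move=> /andP[r1x xr2]; apply/andP; split; exact: ltW. Qed.

Context (alpha : R) (alpha0 : 0 < alpha) (u ua p pa : point3 R -> R).
Context (uP : dirichlet_problem r1 r2 (fun=> g) b q u)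
  (pP : dirichlet_problem r1 r2 (fun x => u x - zd) 0 0 p)
  (uaP : robin_problem r1 r2 alpha (fun=> g) b q ua)
  (paP : robin_problem r1 r2 alpha (fun x => ua x - zd) 0 0 pa).

Let alphan0 : alpha != 0. Proof. by rewrite gt_eqF. Qed.

Lemma stateE x : shell r1 r2 x ->
  u x = rad state0 state1 (- g / 6) 0 0 (enorm x).
Proof.
by move=> /shell_closed; exact: (dirichlet_unique r10 r12 uP dirichlet_state).
Qed.

Lemma robin_stateE x : shell r1 r2 x ->
  ua x = rad (state0 + slope_u / alpha) state1 (- g / 6) 0 0 (enorm x).
Proof.
move=> /shell_closed.
exact: (robin_unique r10 r12 alpha0 uaP (robin_state alphan0)).
Qed.

Lemma state_difference x : shell r1 r2 x ->
  ua x - u x = rad (slope_u / alpha) 0 0 0 0 (enorm x).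
Proof. by move=> sx; rewrite robin_stateE// stateE// /rad; ring. Qed.

Lemma adjoint_difference x : shell r1 r2 x ->
  pa x - p x = rad
    ((slope_p + slope_u * psi0 + slope_u * slope_psi / alpha) / alpha)
    (slope_u * psi1 / alpha) (- slope_u / 6 / alpha) 0 0 (enorm x).
Proof.
move=> sx; have sx' := shell_closed sx.
have paP' := robin_adjoint (f := fun x => ua x - zd) alphan0
  (fun y sy => congr1 (fun t => t - zd) (robin_stateE sy)).
have pP' := dirichlet_adjoint (f := fun x => u x - zd)
  (fun y sy => congr1 (fun t => t - zd) (stateE sy)).
rewrite (robin_unique r10 r12 alpha0 paP paP' (fun _ _ => erefl) sx').
rewrite (dirichlet_unique r10 r12 pP pP' (fun _ _ => erefl) sx').
by rewrite /rad; ring.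
Qed.

Let H := limit_profile.
Let dH := profile_slope.
Let V := 4 / 3 * pi * (r2 ^+ 3 - r1 ^+ 3).
Let m1 := 2 * (slope_u * slope_psi) * shell_integral r1 r2 H.
Let m2 := (slope_u * slope_psi) ^+ 2 * V.

(** The squared norm of [(H + c / alpha) / alpha], expanded. *)
Lemma adjoint_integral :
  shell_integral r1 r2 (fun t => rad
    ((slope_p + slope_u * psi0 + slope_u * slope_psi / alpha) / alpha)
    (slope_u * psi1 / alpha) (- slope_u / 6 / alpha) 0 0 t ^+ 2) =
  alpha^-1 ^+ 2 * (shell_integral r1 r2 (fun t => H t ^+ 2) +
    m1 * alpha^-1 + m2 * alpha^-1 ^+ 2).
Proof.
have cH t : 0 < t -> {for t, continuous H} by exact: rad_continuous.
have -> : (fun t => rad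
    ((slope_p + slope_u * psi0 + slope_u * slope_psi / alpha) / alpha)
    (slope_u * psi1 / alpha) (- slope_u / 6 / alpha) 0 0 t ^+ 2) =
    (fun t => alpha^-1 ^+ 2 * (H t + slope_u * slope_psi / alpha) ^+ 2).
  apply/funext => t; rewrite /H /limit_profile /rad.
  by move: t^-1 => ti; ring.
rewrite (@shell_integralZ _ _ _ _
  (fun t => (H t + slope_u * slope_psi / alpha) ^+ 2))//.
  by rewrite shell_integral_sqr_addc// -/V /m1 /m2; ring.
move=> t t0; apply: continuous_sqr.
by apply: cvgD; [exact: cH|exact: cvg_cst].
Qed.

Lemma adjoint_gradient_integral :
  shell_integral r1 r2 (fun t =>
    drad (slope_u * psi1 / alpha) (- slope_u / 6 / alpha) 0 0 t ^+ 2) =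
  alpha^-1 ^+ 2 * shell_integral r1 r2 (fun t => dH t ^+ 2).
Proof.
have -> : (fun t =>
    drad (slope_u * psi1 / alpha) (- slope_u / 6 / alpha) 0 0 t ^+ 2) =
    (fun t => alpha^-1 ^+ 2 * dH t ^+ 2).
  apply/funext => t; rewrite /dH /profile_slope /drad.
  by move: (t ^+ 2)^-1 => ti; ring.
rewrite (@shell_integralZ _ _ _ _ (fun t => dH t ^+ 2))//.
by move=> t t0; apply: continuous_sqr; exact: drad_continuous.
Qed.

Lemma L2norm_adjoint : L2norm (shell r1 r2) (fun x => pa x - p x) =
  (alpha^-1 * Num.sqrt (shell_integral r1 r2 (fun t => H t ^+ 2) +
    m1 * alpha^-1 + m2 * alpha^-1 ^+ 2))%:E.
Proof.
rewrite (L2norm_rad r10 r12 adjoint_difference) adjoint_integral.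
by rewrite sqrtrM ?sqr_ge0// sqrtr_sqr gtr0_norm ?invr_gt0.
Qed.

Lemma H1norm_adjoint : H1norm (shell r1 r2) (fun x => pa x - p x) =
  (alpha^-1 * Num.sqrt (shell_integral r1 r2 (fun t => H t ^+ 2) +
    shell_integral r1 r2 (fun t => dH t ^+ 2) +
    m1 * alpha^-1 + m2 * alpha^-1 ^+ 2))%:E.
Proof.
rewrite (H1norm_rad r10 r12 adjoint_difference) adjoint_integral.
rewrite adjoint_gradient_integral -mulrDr.
rewrite sqrtrM ?sqr_ge0// sqrtr_sqr gtr0_norm ?invr_gt0//.
by congr (_ * Num.sqrt _)%:E; ring.
Qed.

Lemma H1norm_state : H1norm (shell r1 r2) (fun x => ua x - u x) =
  (Num.sqrt (4 * pi * (r2 ^+ 3 - r1 ^+ 3) *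
             (3 * q * r2 ^+ 2 + g * (r1 ^+ 3 - r2 ^+ 3)) ^+ 2 /
             (27 * r1 ^+ 4)) / alpha)%:E.
Proof.
rewrite (H1norm_rad r10 r12 state_difference).
have -> : (fun t => rad (slope_u / alpha) 0 0 0 0 t ^+ 2) =
    (fun=> (slope_u / alpha) ^+ 2).
  by apply/funext => t; rewrite /rad; ring.
have -> : (fun t => drad 0 0 0 0 t ^+ 2) = (fun=> 0 : R).
  by apply/funext => t; rewrite /drad; ring.
rewrite !shell_integral_cst ?(ltW r10)// mul0r addr0; congr EFin.
have aE : alpha^-1 = Num.sqrt (alpha^-1 ^+ 2).
  by rewrite sqrtr_sqr gtr0_norm ?invr_gt0.
rewrite [in RHS]aE -sqrtrM.
  congr Num.sqrt; rewrite slope_uE; field; rewrite ?r1n0 ?alphan0//.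
apply: mulr_ge0; last by rewrite invr_ge0 mulr_ge0// exprn_ge0// ltW.
apply: mulr_ge0; last exact: sqr_ge0.
rewrite !mulr_ge0 ?pi_ge0// subr_ge0 ltW// ltrXn2r ?nnegrE// ltW//.
Qed.

End ExplicitSolutions.

(** * The asymptotics *)

Theorem mainTheorem9 (R : realType) (r1 r2 g q b zd : R)
    (hr1 : 0 < r1) (hr12 : r1 < r2) :
  exists K3 L3 : R,
    K3 = Num.sqrt (4 * pi * (r2 ^+ 3 - r1 ^+ 3) *
                   (3 * q * r2 ^+ 2 + g * (r1 ^+ 3 - r2 ^+ 3)) ^+ 2 /
                   (27 * r1 ^+ 4)) /\
    forall (u p : point3 R -> R) (u_ p_ : R -> point3 R -> R),
      dirichlet_problem r1 r2 (fun=> g) b q u ->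
      dirichlet_problem r1 r2 (fun x => u x - zd) 0 0 p ->
      (forall alpha, 0 < alpha ->
         robin_problem r1 r2 alpha (fun=> g) b q (u_ alpha)) ->
      (forall alpha, 0 < alpha ->
         robin_problem r1 r2 alpha (fun x => u_ alpha x - zd) 0 0 (p_ alpha)) ->
      [/\ (H1norm (shell r1 r2) (fun x => u_ alpha x - u x))
            @[alpha --> +oo] --> 0%E,
          (H1norm (shell r1 r2) (fun x => p_ alpha x - p x))
            @[alpha --> +oo] --> 0%E,
          (forall alpha, 0 < alpha ->
             H1norm (shell r1 r2) (fun x => u_ alpha x - u x) =
               (K3 / alpha)%:E) /\
          (~ (forall alpha x, 0 < alpha -> shell r1 r2 x ->
                u_ alpha x = u x) -> 0 < K3) &
          (alpha%:E * L2norm (shell r1 r2) (fun x => p_ alpha x - p x)%R)%E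
            @[alpha --> +oo] --> L3%:E /\
          (~ (forall alpha x, 0 < alpha -> shell r1 r2 x ->
                p_ alpha x = p x) -> 0 < L3)].
Proof.
set K3 := Num.sqrt _.
pose H := limit_profile r1 r2 g q b zd.
pose dH := profile_slope r1 r2 g q.
pose m1 := 2 * (slope_u r1 r2 g q * slope_psi r1 r2) * shell_integral r1 r2 H.
pose m2 := (slope_u r1 r2 g q * slope_psi r1 r2) ^+ 2 *
  (4 / 3 * pi * (r2 ^+ 3 - r1 ^+ 3)).
pose L3 := Num.sqrt (shell_integral r1 r2 (fun t => H t ^+ 2)).
exists K3, L3; split => // u p u_ p_ uP pP uaP paP.
have inv0 : alpha^-1 @[alpha --> +oo] --> (0 : R).
  by apply/gtr0_cvgV0; [exact: nbhs_pinfty_gt|exact: cvg_id].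
have diffu alpha : 0 < alpha -> forall x, shell r1 r2 x ->
    u_ alpha x - u x = rad (slope_u r1 r2 g q / alpha) 0 0 0 0 (enorm x).
  by move=> a0; exact: (state_difference hr1 hr12 a0 uP (uaP _ a0)).
have diffp alpha (a0 : 0 < alpha) :=
  adjoint_difference hr1 hr12 a0 uP pP (uaP _ a0) (paP _ a0).
have H1u alpha (a0 : 0 < alpha) := H1norm_state hr1 hr12 a0 uP (uaP _ a0).
have H1p alpha (a0 : 0 < alpha) :=
  H1norm_adjoint hr1 hr12 a0 uP pP (uaP _ a0) (paP _ a0).
have L2p alpha (a0 : 0 < alpha) :=
  L2norm_adjoint hr1 hr12 a0 uP pP (uaP _ a0) (paP _ a0).
split.
- apply: (@cvg_trans _ ((fun alpha : R => (K3 / alpha)%:E) @ +oo)).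
    apply: near_eq_cvg; near=> alpha.
    have a0 : 0 < alpha by near: alpha; exact: nbhs_pinfty_gt.
    by rewrite (H1u _ a0).
  apply: cvg_EFin; first by near=> alpha.
  rewrite -(mulr0 K3); apply: cvgM; [exact: cvg_cst|exact: inv0].
- apply: (@cvg_trans _ ((fun alpha : R => (alpha^-1 * Num.sqrt
      (shell_integral r1 r2 (fun t => H t ^+ 2) +
       shell_integral r1 r2 (fun t => dH t ^+ 2) +
       m1 * alpha^-1 + m2 * alpha^-1 ^+ 2))%:E) @ +oo)).
    apply: near_eq_cvg; near=> alpha.
    have a0 : 0 < alpha by near: alpha; exact: nbhs_pinfty_gt.
    by rewrite (H1p _ a0).
  apply: cvg_EFin; first by near=> alpha.
  rewrite -(mul0r (Num.sqrt (shell_integral r1 r2 (fun t => H t ^+ 2) +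
    shell_integral r1 r2 (fun t => dH t ^+ 2)))).
  by apply: cvgM; [exact: inv0|exact: cvg_sqrt_quadratic].
- split => // uneq.
  have dun0 : slope_u r1 r2 g q != 0.
    apply/eqP => du0; apply: uneq => alpha x a0 sx.
    apply/eqP; rewrite -subr_eq0 (diffu _ a0 _ sx) du0 /rad.
    by apply/eqP; ring.
  have Nn0 : 3 * q * r2 ^+ 2 + g * (r1 ^+ 3 - r2 ^+ 3) != 0.
    by apply: contraNneq dun0 => N0; rewrite slope_uE// N0 oppr0 mul0r.
  rewrite sqrtr_gt0; apply: divr_gt0; last by rewrite mulr_gt0// exprn_gt0.
  apply: mulr_gt0; last by rewrite lt_neqAle eq_sym sqrf_eq0 Nn0 sqr_ge0.
  have r20 := lt_trans hr1 hr12.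
  by rewrite !mulr_gt0 ?pi_gt0// subr_gt0 ltrXn2r ?nnegrE ?(ltW hr1) ?(ltW r20).
- split.
    apply: (@cvg_trans _ ((fun alpha : R => (Num.sqrt
        (shell_integral r1 r2 (fun t => H t ^+ 2) +
         m1 * alpha^-1 + m2 * alpha^-1 ^+ 2))%:E) @ +oo)).
      apply: near_eq_cvg; near=> alpha.
      have a0 : 0 < alpha by near: alpha; exact: nbhs_pinfty_gt.
      by rewrite (L2p _ a0) -EFinM mulVKf// gt_eqF.
    apply: cvg_EFin; first by near=> alpha.
    exact: cvg_sqrt_quadratic.
  move=> pneq; rewrite sqrtr_gt0.
  have [|t tI Ht] := @limit_profile_neq0 _ r1 r2 g q b zd hr1 hr12.
    apply/negPn/negP; rewrite negb_or !negbK => /andP[/eqP du0 /eqP dp0].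
    apply: pneq => alpha x a0 sx.
    apply/eqP; rewrite -subr_eq0 (diffp _ a0 _ sx) du0 dp0 /rad.
    by apply/eqP; ring.
  apply: (shell_integral_sqr_gt0 hr1 hr12 _ tI Ht) => t' t'0.
  exact: rad_continuous.
Unshelve. all: by end_near. Qed.
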